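(* Suppose $\Delta$ is a building whose apartments are the Coxeter complex of a word hyperbolic Coxeter group, and that $G$ is a finitely generated group which acts simplicially, co-compactly and with finite stabilizers on $\Delta$. Then $G$ is word hyperbolic.
   Context: A building $\Delta$ is a simplicial complex that is a union of apartments in the usual sense; here each apartment is isomorphic to the Coxeter complex of a Coxeter system $(W,S)$ whose group $W$ is word hyperbolic. ''Co-compactly'' means that there are finitely many $G$-orbits of simplices of $\Delta$; in particular there are finitely many $G$-orbits of chambers and of codimension-one faces of chambers. ''With finite stabilizers'' means that the setwise stabilizers in $G$ of the simplices of $\Delta$ are finite; in particular the setwise stabilizer of each chamber and of each codimension-one face of a chamber is finite. Hyperbolicity: a geodesic metric space $(X,d)$ is $\delta$-hyperbolic if whenever $P$ is a point on side $\alpha$ of a geodesic triangle with sides $\alpha,\beta,\gamma$, there is a point $Q$ on $\beta\cup\gamma$ with $d(P,Q)\le\delta$; it is hyperbolic if it is $\delta$-hyperbolic for some $\delta$. A finitely generated group is (word) hyperbolic if its Cayley graph with respect to some (equivalently, any) finite generating set, with each edge isometric to the unit interval and with the induced path metric, is hyperbolic. *)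

(* Defs.v *)
From mathcomp Require Import all_boot all_order all_algebra.
From mathcomp Require Import all_classical all_reals.

Set Implicit Arguments.
Unset Strict Implicit.
Unset Printing Implicit Defensive.

Import Order.TTheory GRing.Theory Num.Theory.
Local Open Scope classical_set_scope.
Local Open Scope ring_scope.

(** * Hyperbolic geodesic metric spaces *)

(* A metric is given by an explicit distance function, because a group carries
   one Cayley graph metric for each generating set. *)
Section HyperbolicSpaces.
Variables (R : realType) (X : Type) (d : X -> X -> R).

Definition is_metric : Prop :=
  [/\ forall x y, 0 <= d x y,
      forall x y, d x y = 0 <-> x = y,
      forall x y, d x y = d y x
    & forall x y z, d x z <= d x y + d y z].

Definition geodesic_segment (x y : X) (A : set X) : Prop :=
  exists (L : R) (c : R -> X),
    [/\ 0 <= L, c 0 = x, c L = y,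
        forall s t, 0 <= s <= L -> 0 <= t <= L -> d (c s) (c t) = `|s - t|
      & A = c @` [set t | 0 <= t <= L]].

Definition geodesic_space : Prop :=
  forall x y, exists A, geodesic_segment x y A.

Definition delta_hyperbolic (delta : R) : Prop :=
  forall (x y z : X) (alpha beta gamma : set X),
    geodesic_segment x y alpha ->
    geodesic_segment y z beta ->
    geodesic_segment z x gamma ->
    forall P, alpha P ->
      exists2 Q, (beta `|` gamma) Q & d P Q <= delta.

Definition hyperbolic_space : Prop :=
  [/\ is_metric, geodesic_space & exists delta, delta_hyperbolic delta].

End HyperbolicSpaces.

(** * Metric graphs with unit edges *)

Section MetricGraph.
Variables (R : realType) (V : eqType) (adj : V -> V -> Prop).

(* Points of the realization are given by their barycentric coordinates. *)
Definition edge_point (v w : V) (t : R) : V -> R :=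
  fun u => (1 - t) * (u == v)%:R + t * (u == w)%:R.

(* The case v = w, for which edge_point v v t is the vertex v itself, makes
   isolated vertices points of the realization. *)
Definition cell (v w : V) : Prop := v = w \/ adj v w.

Definition on_cell (v w : V) (x : V -> R) : Prop :=
  exists2 t, 0 <= t <= 1 & x = edge_point v w t.

Definition graph_point : Type :=
  {x : V -> R | exists v w, cell v w /\ on_cell v w x}.

(* Piecewise linear paths and their lengths: on a closed edge {v, w} of
   length 1 the distance between two points is the difference of their
   coordinates at v. *)
Inductive pl_path : graph_point -> graph_point -> R -> Prop :=
| pl_path_nil x : pl_path x x 0
| pl_path_cons x y z v w l :
    cell v w -> on_cell v w (sval x) -> on_cell v w (sval y) ->
    pl_path y z l ->
    pl_path x z (`|sval x v - sval y v| + l).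

(* Only meaningful when the graph is connected: inf set0 = 0. *)
Definition graph_dist (x y : graph_point) : R := inf [set l | pl_path x y l].

End MetricGraph.

(** * Generation and word hyperbolic groups *)

Section Groups.
Variable G : groupType.

Definition subgroup (H : set G) : Prop :=
  [/\ H 1%g, forall x y, H x -> H y -> H (x * y)%g
    & forall x, H x -> H (x^-1)%g].

Definition generated (A : set G) : set G := smallest subgroup A.

Definition finitely_generated : Prop :=
  exists2 A : set G, finite_set A & generated A = setT.

(* Loops and multiple edges are discarded. *)
Definition cayley_adj (A : set G) (g h : G) : Prop :=
  g <> h /\ exists2 a, A a & h = (g * a)%g \/ g = (h * a)%g.

Definition word_hyperbolic (R : realType) : Prop :=
  exists A : set G, [/\ finite_set A, generated A = setT
    & hyperbolic_space (@graph_dist R G (cayley_adj A))].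

End Groups.

(** * Coxeter systems and Coxeter complexes *)

Section Coxeter.
Variables (W : groupType) (S : set W).

(* It is equivalent to let m range over all exponents killing s * t, or to
   allow only its order; s = t, m = 1 gives the relators s s. *)
Definition coxeter_relator (r : seq W) : Prop :=
  exists s t m, [/\ S s, S t, ((s * t) ^+ m = 1)%g
    & r = flatten (nseq m [:: s; t])].

Inductive coxeter_equiv : seq W -> seq W -> Prop :=
| coxeter_equiv_refl u : coxeter_equiv u u
| coxeter_equiv_sym u v : coxeter_equiv u v -> coxeter_equiv v u
| coxeter_equiv_trans u v w :
    coxeter_equiv u v -> coxeter_equiv v w -> coxeter_equiv u w
| coxeter_equiv_relator u r v :
    coxeter_relator r -> coxeter_equiv (u ++ v) (u ++ r ++ v).

(* (W, S) is a Coxeter system: S consists of involutions, and W has the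
   presentation < S | (s t)^m(s,t) = 1 >, m(s,t) being the order of s t.
   Words without inverses suffice, the generators being involutions. *)
Definition coxeter_system : Prop :=
  [/\ forall s, S s -> s <> 1%g /\ (s * s = 1)%g,
      generated S = setT
    & forall u v : seq W,
        (forall s, s \in u -> S s) -> (forall s, s \in v -> S s) ->
        foldr (fun x y => x * y)%g 1%g u = foldr (fun x y => x * y)%g 1%g v ->
        coxeter_equiv u v].

(* The simplices of the Coxeter complex are the cosets w W_T with T a subset
   of S, ordered by reverse inclusion; W itself is the empty simplex and
   the cosets {w} are the chambers. *)
Definition special_coset : set (set W) :=
  [set A | exists w T, T `<=` S /\ A = [set (w * x)%g | x in generated T]].

End Coxeter.

(** * Simplicial complexes and buildings *)

Section Complexes.
Variable V : Type.
Implicit Types (D E F : set (set V)) (sigma tau : set V).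

(* A complex is the set of its simplices, including the empty one. *)
Definition simplicial_complex D : Prop :=
  [/\ D set0, forall v, D [set v],
      forall sigma, D sigma -> finite_set sigma
    & forall sigma tau, D sigma -> tau `<=` sigma -> D tau].

Definition subcomplex E D : Prop :=
  [/\ E set0, E `<=` D
    & forall sigma tau, E sigma -> tau `<=` sigma -> E tau].

Definition vertices E : set V := [set v | E [set v]].

Definition complex_iso E F (phi : V -> V) : Prop :=
  set_bij (vertices E) (vertices F) phi /\
  forall sigma, sigma `<=` vertices E -> (E sigma <-> F (phi @` sigma)).

Definition chamber D sigma : Prop :=
  D sigma /\ forall tau, D tau -> sigma `<=` tau -> tau = sigma.

Definition codim1_face_of_chamber D tau : Prop :=
  exists C v, [/\ chamber D C, C v & tau = C `\ v].

Definition is_coxeter_complex (W : groupType) (S : set W) E : Prop :=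
  exists f : set W -> set V,
    set_bij (special_coset S) E f /\
    forall A B, special_coset S A -> special_coset S B ->
      (B `<=` A <-> f A `<=` f B).

Definition apartment_system (W : groupType) (S : set W) D
    (Apt : set (set (set V))) : Prop :=
  [/\ forall E, Apt E -> subcomplex E D /\ is_coxeter_complex S E,
      D = \bigcup_(E in Apt) E,
      forall sigma tau, D sigma -> D tau ->
        exists E, [/\ Apt E, E sigma & E tau]
    & forall E F sigma tau, Apt E -> Apt F ->
        E sigma -> E tau -> F sigma -> F tau ->
        exists phi, complex_iso E F phi /\
          forall v, (sigma `|` tau) v -> phi v = v].

(* Buildings are not assumed to be thick. *)
Definition building (W : groupType) (S : set W) D : Prop :=
  simplicial_complex D /\ exists Apt, apartment_system S D Apt.

End Complexes.

(** * Simplicial actions *)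

Section Actions.
Variables (G : groupType) (V : Type) (D : set (set V)) (to : G -> V -> V).

Definition simplicial_action : Prop :=
  [/\ forall v, to 1%g v = v,
      forall g h v, to (g * h)%g v = to g (to h v)
    & forall g sigma, D sigma -> D (to g @` sigma)].

Definition simplex_orbit (sigma : set V) : set (set V) :=
  [set to g @` sigma | g in setT].

Definition cocompact : Prop :=
  finite_set [set simplex_orbit sigma | sigma in D].

Definition setwise_stabilizer (sigma : set V) : set G :=
  [set g | to g @` sigma = sigma].

(* The empty simplex, which all of G stabilizes, is exempted unless it is a
   chamber or a codimension-one face of a chamber. This matters only in rank
   at most 1: any group acts freely by translations on the rank 1 building
   whose vertices are its elements and whose apartments are the pairs of
   vertices. *)
Definition finite_stabilizers : Prop :=
  forall sigma, D sigma ->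
    [\/ sigma !=set0, chamber D sigma | codim1_face_of_chamber D sigma] ->
    finite_set (setwise_stabilizer sigma).

End Actions.

(* Main.v *)
Require Import Defs.
From mathcomp Require Import all_boot all_order all_algebra.
From mathcomp Require Import all_classical all_reals.
From mathcomp Require Import zify lra.

(** The proof rests on a reformulation of hyperbolicity that retractions of the
   building preserve.  A graph metric d satisfies [hyp_nat d K] when, for every
   c on a geodesic from x to y and every z,

     d(z,c) + d(x,c) <= d(x,z) + K   or   d(z,c) + d(y,c) <= d(y,z) + K.

   Up to the value of the constant this is thinness of geodesic triangles, by a
   few triangle inequalities ([hyp_thin], [thin_hyp]).  In contrast with
   thinness, the third vertex z enters only through its distances to x, y and
   c, and d(z,c) is to be bounded above by expressions that increase with
   d(x,z) and d(y,z).

   In the chamber graph of the building, take an apartment containing the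
   chambers x and y, a chamber c of it on a geodesic from x to y, and any
   chamber z.  The retraction onto this apartment centred at c fixes x, y and
   c, preserves the distance from c to z, and does not increase the distances
   from x and from y to z.  Hence the inequality for the image of z, which
   takes place in the Cayley graph of (W, S), gives the inequality for z
   ([hyp_retractions], [chamber_graph_hyp]): geodesic triangles of the building
   never have to be placed in a single apartment.  The retraction is built
   from isomorphisms between apartments that fix c; it is well behaved because
   such an isomorphism is determined by its values on c ([iso_rigid],
   [chamber_retraction]).

   The other steps are changes of metric.  Hyperbolicity is invariant under
   quasi-isometric embeddings ([hyp_quasi_isometric]), by stability of
   quasi-geodesics ([geodesic_near_quasi], [quasi_near_geodesic]).  This is
   used to pass from an arbitrary finite generating set of W to S, which is
   finite because chambers are ([generators_finite]), and to pass from the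
   chamber graph to G, an orbit map being a quasi-isometric embedding by the
   argument of Milnor and Schwarz ([orbit_map_quasi_isometric]).  Finally,
   distances between vertices in the realization of a graph are the
   combinatorial ones, so that the realization is hyperbolic if and only if the
   vertex set is ([hyperbolic_graphP]). *)

Set Implicit Arguments.
Unset Strict Implicit.
Unset Printing Implicit Defensive.

(** * Hyperbolicity of integer-valued geodesic metrics *)

Section DiscreteGeodesic.
Variables (X : Type) (d : X -> X -> nat).

Definition between x c y := d x c + d c y = d x y.

Record geodesic_nat : Prop := GeodesicNat {
  gn_refl : forall x, d x x = 0;
  gn_eq0 : forall x y, d x y = 0 -> x = y;
  gn_sym : forall x y, d x y = d y x;
  gn_tri : forall x y z, d x z <= d x y + d y z;
  gn_mid : forall x y k, k <= d x y -> exists2 c, d x c = k & between x c y }.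

(** The four-point inequality for x, y, z and a point c between x and y, with
   the subtraction of d(x,c) or d(y,c) cleared. *)
Definition hyp_nat K := forall x y c z, between x c y ->
  d z c + d x c <= d x z + K \/ d z c + d y c <= d y z + K.

Definition thin_nat K := forall x y z c, between x c y ->
  exists2 q, between y q z \/ between z q x & d c q <= K.

Hypothesis gd : geodesic_nat.

Lemma between_sym x c y : between x c y -> between y c x.
Proof. by rewrite /between (gn_sym gd y c) (gn_sym gd c x) (gn_sym gd y x) addnC. Qed.

(** A point whose distances to x and y almost add up to d(x,y) is close to the
   point of a geodesic at the same distance from x: apply [hyp_nat] to that
   point, the given one being the third vertex. *)
Lemma near_hyp K : hyp_nat K -> forall x y p, exists2 q, between x q y &
  d p q <= (d x p + d p y - d x y) + K.
Proof.
move=> hK x y p.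
have [q xq bq] := gn_mid gd (geq_minr (d x p) (d x y)).
exists q => //.
move: bq (hK x y q p bq) (gn_tri gd x p y) (gn_sym gd q y) (gn_sym gd p y).
by rewrite /between xq; lia.
Qed.

Lemma hyp_almost_between K e : hyp_nat K -> forall x y c z,
  d x c + d c y <= d x y + e ->
  d z c + d x c <= d x z + (3 * K + 2 * e) \/
  d z c + d y c <= d y z + (3 * K + 2 * e).
Proof.
move=> hK x y c z bc; have T := gn_tri gd; have E := gn_sym gd.
have [q bq dq] := near_hyp hK x y c.
have dq' : d c q <= e + K by move: bc dq; lia.
case: (hK x y q z bq) => h; [left|right].
  by move: (T z q c) (T x q c) (E c q); lia.
by move: (T z q c) (T y q c) (E c q); lia.
Qed.

(** If the first alternative of [hyp_nat] holds for z, then c almost lies between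
   x and z, so [near_hyp] yields a nearby point of the side from x to z; the
   second alternative yields a point of the side from y to z. *)
Lemma hyp_thin K : hyp_nat K -> thin_nat (K + K).
Proof.
move=> hK x y z c bc.
have E1 := gn_sym gd; case: (hK x y c z bc) => h.
- have [q bq dq] := near_hyp hK z x c.
  exists q; first by right.
  by move: (E1 z c) (E1 c x) (E1 z x); lia.
- have [q bq dq] := near_hyp hK y z c.
  exists q; first by left.
  by move: (E1 z c) (E1 c y) (E1 z y); lia.
Qed.

Lemma thin_hyp K : thin_nat K -> hyp_nat (K + K).
Proof.
move=> hK x y c z bc.
have T := gn_tri gd; have E1 := gn_sym gd.
have [q [bq|bq] dq] := hK x y z c bc; [right | left].
- by move: bq; rewrite /between; move: (T z q c) (T y q c) (E1 c q) (E1 z q); lia.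
- by move: bq; rewrite /between; move: (T z q c) (T x q c) (E1 c q) (E1 x q) (E1 x z); lia.
Qed.

Lemma geodesic_path x y : exists p : nat -> X,
  [/\ p 0 = x, p (d x y) = y & forall i, i < d x y -> d (p i) (p i.+1) <= 1].
Proof.
have [n En] : exists n, d x y = n by exists (d x y).
rewrite En; elim: n x En => [|n IH] x En.
  by exists (fun=> x); split=> //; apply: (gn_eq0 gd).
have [|z xz bz] := @gn_mid gd x y 1; first by lia.
have [|p [p0 pn pS]] := IH z; first by move: bz; rewrite /between; lia.
exists (fun i => if i is j.+1 then p j else x); split=> //.
by case=> [_|i ilt]; [rewrite p0 xz | exact: pS].
Qed.

Lemma geodesic_path_through x c y : between x c y -> exists p : nat -> X,
  [/\ p 0 = x, p (d x c) = c, p (d x y) = y &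
      forall i, i < d x y -> d (p i) (p i.+1) <= 1].
Proof.
move=> bc.
have [p [p0 pn pS]] := geodesic_path x c.
have [r [r0 rn rS]] := geodesic_path c y.
exists (fun i => if i <= d x c then p i else r (i - d x c)).
have dcy : d x y - d x c = d c y by move: bc; rewrite /between; lia.
split=> [|||i ilt] //; first by rewrite leqnn.
- case: leqP => h; last by rewrite dcy.
  have dc0 : d c y = 0 by move: bc; rewrite /between; lia.
  have -> : d x y = d x c by move: bc; rewrite /between; lia.
  by rewrite pn (gn_eq0 gd dc0).
- case: (ltngtP i (d x c)) => h.
  + exact: pS.
  + rewrite subSn; last by lia.
    by apply: rS; lia.
  + by rewrite h pn subSnn -r0; apply: rS; move: bc; rewrite /between; lia.
Qed.

Lemma path_lipschitz (p : nat -> X) n i j L : i <= j -> j <= n ->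
  (forall i, i < n -> d (p i) (p i.+1) <= L) -> d (p i) (p j) <= L * (j - i).
Proof.
move=> ij jn pS; elim: j ij jn => [|j IH] ij jn.
  by rewrite (_ : i = 0) ?(gn_refl gd)//; lia.
move: ij; rewrite leq_eqVlt => /orP[/eqP->|ij]; first by rewrite (gn_refl gd).
have := IH ij (ltnW jn); have := pS j jn; have := gn_tri gd (p i) (p j) (p j.+1).
by rewrite subSn // mulnS; lia.
Qed.

(** A path of unit steps that is as short as the distance of its ends allows has
   no slack anywhere. *)
Lemma geodesic_path_dist (p : nat -> X) n i j : i <= j -> j <= n ->
  (forall i, i < n -> d (p i) (p i.+1) <= 1) -> d (p 0) (p n) = n ->
  d (p i) (p j) = j - i.
Proof.
move=> ij jn pS pn.
have := @path_lipschitz p n 0 i 1 (leq0n _) (leq_trans ij jn) pS.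
have := @path_lipschitz p n i j 1 ij jn pS.
have := @path_lipschitz p n j n 1 jn (leqnn _) pS.
have := gn_tri gd (p 0) (p i) (p n); have := gn_tri gd (p i) (p j) (p n).
lia.
Qed.

End DiscreteGeodesic.

(** Here k is an apartment through x and y, and r a retraction onto it centred at
   k a.  The inequality is obtained for c in the image of k, with the retraction
   centred at c.  Another point c between x and y is close to the point c' in
   the image of k at the same distance from x, by the inequality for c' and the
   third vertex c; so it inherits the inequality with a larger constant. *)
Lemma hyp_retractions (X Y : Type) (dX : X -> X -> nat) (dY : Y -> Y -> nat) (K : nat) :
  geodesic_nat dX -> geodesic_nat dY ->
  (forall x y, exists k : Y -> X,
     [/\ exists a, k a = x, exists b, k b = y,
         forall a b, dX (k a) (k b) <= dY a b
       & forall a, exists r : X -> Y,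
         [/\ forall b, r (k b) = b, forall u v, dY (r u) (r v) <= dX u v
           & forall u, dX (k a) u <= dY a (r u)]]) ->
  hyp_nat dY K -> exists K', hyp_nat dX K'.
Proof.
move=> gX gY ret hK.
have T := gn_tri gX; have E := gn_sym gX.
pose good x y c := between dX x c y /\ forall z,
  dX z c + dX x c <= dX x z + K \/ dX z c + dX y c <= dX y z + K.
have goodE x y i : i <= dX x y -> exists2 c, dX x c = i & good x y c.
  have [k [[a <-] [b <-] kL kr]] := ret x y.
  have dk a1 b1 : dX (k a1) (k b1) = dY a1 b1.
    apply/eqP; rewrite eqn_leq kL /=; have [r [rk rL _]] := kr a1.
    by rewrite -{1}(rk a1) -{1}(rk b1) rL.
  rewrite dk => /(gn_mid gY)[c ac bc].
  exists (k c); first by rewrite dk.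
  split; first by rewrite /between !dk.
  move=> z; have [r [rk rL rc]] := kr c.
  have := hK a b c (r z) bc.
  have := rL (k a) z; have := rL (k b) z; rewrite !rk !dk (E z).
  have := rc z; rewrite (gn_sym gY (r z) c); lia.
exists (3 * K) => x y c z bc.
have [c' xc' [bc' hc']] := goodE x y (dX x c) ltac:(move: bc; rewrite /between; lia).
have := hc' c; have := hc' z; have := T z c' c; have := E c' c.
move: bc bc'; rewrite /between; move: (E c y) (E c' y); lia.
Qed.

(** * Stability of quasi-geodesics *)

Lemma linear_le_exp2 a b : exists N, forall n, N <= n -> a * n + b <= 2 ^ n.
Proof.
(* 2 ^ (2m) is at least m * m, which dominates 2am + b. *)
pose m := (2 * a + b).+1; exists (2 * m) => n.
have hm : m < 2 ^ m by apply: ltn_expl.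
have hN : a * (2 * m) + b <= 2 ^ (2 * m).
  rewrite mulnC expnM -[2 ^ 2]/(2 * 2) expnMn.
  apply: (@leq_trans (m * m)); last by apply: leq_mul; apply: ltnW.
  by rewrite /m; nia.
have ha : a <= 2 ^ (2 * m).
  apply: leq_trans (_ : 2 ^ m <= _); last by rewrite leq_exp2l //; lia.
  by apply: leq_trans (ltnW hm); rewrite /m; lia.
elim: n => [|n IH] hn; first by rewrite (_ : 0 = 2 * m) //; lia.
move: hn; rewrite leq_eqVlt => /orP[/eqP <-//|hn].
have := IH hn; rewrite expnS mulnS mul2n -addnn.
have : 2 ^ (2 * m) <= 2 ^ n by rewrite leq_exp2l.
lia.
Qed.

(** Used for the distance D between a geodesic and a quasi-geodesic: the
   premise bounds D by a logarithm of D. *)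
Lemma log_bound K L : exists D0, forall D,
  (forall k, L * (6 * D + 1) <= 2 ^ k -> D <= (k + 2) * K + L) -> D <= D0.
Proof.
pose M := K.+1.
have [N hN] := linear_le_exp2 (L * (12 * M)) (L * (12 * M + 1)).
exists (2 * M * N + 4 * M + 2 * L) => D hD; rewrite leqNgt; apply/negP => Dgt.
(* With this k, of the order of D, (k + 2) * K + L is still less than D. *)
pose k := D %/ (2 * M).
have D1 : D < 2 * M * (k + 1) by rewrite addn1 mulnC; apply: ltn_ceil; rewrite /M; lia.
have D2 : k * (2 * M) <= D by apply: leq_trunc_div.
have Nk : N <= k by rewrite leq_divRL /M; nia.
have := hD k; have := hN k Nk => h1 h2.
have /h2 : L * (6 * D + 1) <= 2 ^ k.
  apply: leq_trans h1; rewrite -mulnA -mulnDr leq_mul2l; apply/orP; right; nia.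
by rewrite /M in D2 Dgt *; nia.
Qed.

Section Morse.
Variables (Y : Type) (d : Y -> Y -> nat).
Hypothesis gd : geodesic_nat d.
Variable K : nat.
Hypothesis thinK : thin_nat d K.

(** Bisecting the path and using thin triangles at each stage, the distance from
   a geodesic to a path with the same ends is logarithmic in the length of the
   path. *)
Lemma geodesic_near_path (q : nat -> Y) L k a b c : a <= b -> b - a <= 2 ^ k ->
  (forall i, a <= i -> i < b -> d (q i) (q i.+1) <= L) ->
  between d (q a) c (q b) -> exists i, [/\ a <= i, i <= b & d c (q i) <= k * K + L].
Proof.
elim: k a b c => [|k IH] a b c ab bk qS bc.
  have E := gn_sym gd c (q a).
  exists a; split=> //; rewrite mul0n add0n E.
  move: bk bc; rewrite expn0 /between leq_eqVlt => /orP[/eqP ba1|ba0].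
    have b1 : b = a.+1 by lia.
    by move: (qS a); rewrite -b1; lia.
  have -> : b = a by lia.
  by rewrite (gn_refl gd); lia.
pose m := (a + b) %/ 2.
have am : a <= m by rewrite /m; lia.
have mb : m <= b by rewrite /m; lia.
have mk : b - m <= 2 ^ k /\ m - a <= 2 ^ k.
  by move: bk; rewrite expnS /m; lia.
have [u [bu|bu] du] := @thinK _ _ (q m) _ bc.
- have [|i [i1 i2 i3]] := IH m b u mb mk.1 _ (between_sym gd bu).
    by move=> i ? ?; apply: qS; lia.
  exists i; split=> //; first by lia.
  by move: (gn_tri gd c u (q i)); rewrite mulSn; lia.
- have [|i [i1 i2 i3]] := IH a m u am mk.2 _ (between_sym gd bu).
    by move=> i ? ?; apply: qS; lia.
  exists i; split=> //; first by lia.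
  by move: (gn_tri gd c u (q i)); rewrite mulSn; lia.
Qed.

Variable L : nat.

Definition quasi_geodesic (q : nat -> Y) n :=
  (forall i, i < n -> d (q i) (q i.+1) <= L) /\
  (forall i j, i <= j -> j <= n -> j - i <= L * (d (q i) (q j) + 1)).

Lemma quadrilateral_thin (x y z t c : Y) : between d x c y ->
  exists2 u, [\/ between d x u z, between d z u t | between d t u y] &
    d c u <= K + K.
Proof.
move=> bc; have [u [bu|bu] du] := @thinK _ _ z _ bc; last first.
  exists u; last by lia.
  by constructor 1; apply: between_sym bu.
have [v [bv|bv] dv] := @thinK _ _ t _ bu.
  exists v; first by constructor 2.
  by move: (gn_tri gd c u v); lia.
exists v; first by constructor 3.
by move: (gn_tri gd c u v); lia.
Qed.

(** Let D be the largest distance from a point c between the ends to the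
   quasi-geodesic q.  Choose y and z on both sides of c at distance 2D (or at
   the ends of q), and q i, q j at distance at most D from y, z.  As y and z are
   too far for the sides from y to q i and from z to q j to come near c, the
   point c is close, unless D is small, to a geodesic from q i to q j, hence, up
   to a logarithm of D, to q: but it is at distance D from q. *)
Lemma geodesic_near_quasi : exists D0, forall q n, quasi_geodesic q n ->
  forall c, between d (q 0) c (q n) -> exists2 i, i <= n & d c (q i) <= D0.
Proof.
have [D0 hD0] := log_bound K L.
exists (D0 + 2 * K) => q n [q1 q2].
pose P D := forall c, between d (q 0) c (q n) -> exists2 i, i <= n & d c (q i) <= D.
have exP : exists D, `[< P D >].
  exists (d (q 0) (q n)); apply/asboolP => c bc; exists 0 => //.
  by move: bc (gn_sym gd c (q 0)); rewrite /between; lia.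
case: (ex_minnP exP) => D /asboolP PD minD.
suff DD0 : D <= D0 + 2 * K.
  by move=> c bc; have [i ? ?] := PD c bc; exists i => //; lia.
case: (posnP D) => [->//|Dpos].
have [c bc far] : exists2 c, between d (q 0) c (q n) &
    forall i, i <= n -> D <= d c (q i).
  apply: contrapT => no.
  have /minD : `[< P D.-1 >]; last by lia.
  apply/asboolP => c bc; apply: contrapT => noi; apply: no; exists c => // i il.
  rewrite leqNgt; apply/negP => lt; apply: noi; exists i => //; lia.
have bc' := bc; rewrite /between in bc'.
have T := gn_tri gd; have E := gn_sym gd.
have [y [i [yb1 yb2 il yD yor]]] : exists y i, [/\ d (q 0) y + d y c = d (q 0) c,
   d y c <= 2 * D, i <= n, d y (q i) <= D & d y c = 2 * D \/ y = q i].
  case: (leqP (2 * D) (d (q 0) c)) => h.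
    have [|y y1 y2] := @gn_mid _ _ gd (q 0) c (d (q 0) c - 2 * D); first by lia.
    rewrite /between in y2; have [|i il iD] := PD y.
      by move: (T (q 0) y (q n)) (T y c (q n)); rewrite /between; lia.
    by exists y, i; split=> //; [lia | left; lia].
  by exists (q 0), 0; rewrite !(gn_refl gd); split=> //; first [lia | by right].
have [z [j [zb1 zb2 jl zD zor]]] : exists z j, [/\ d c z + d z (q n) = d c (q n),
   d c z <= 2 * D, j <= n, d z (q j) <= D & d c z = 2 * D \/ z = q j].
  case: (leqP (2 * D) (d c (q n))) => h.
    have [z z1 z2] := gn_mid gd h.
    rewrite /between in z2; have [|j jl jD] := PD z.
      by move: (T (q 0) z (q n)) (T (q 0) c z); rewrite /between; lia.
    by exists z, j; split=> //; [lia | left; lia].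
  by exists (q n), n; rewrite !(gn_refl gd); split=> //; first [lia | by right].
have byz : between d y c z.
  move: (T y c z) (T (q 0) y (q n)) (T y z (q n)) ; rewrite /between; lia.
have [u bu du] := quadrilateral_thin (q i) (q j) byz.
case: bu => [bu|bu|bu].
- rewrite /between in bu; case: yor => [h|h].
    move: (T y u c) (E u c); lia.
  move: (T c u (q i)) (far i il) bu; rewrite h (gn_refl gd); lia.
- suff : D <= D0 by lia.
  apply: hD0 => k hk.
  have dij : d (q i) (q j) <= 6 * D.
    move: (T (q i) y (q j)) (T y c (q j)) (T c z (q j)) (E (q i) y); lia.
  have [m [ml dm]] : exists m, m <= n /\ d u (q m) <= k * K + L.
    case: (leqP i j) => ij.
      have [||m [? ? ?]] := @geodesic_near_path q L k i j u ij _ _ bu.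
      + by apply: leq_trans hk; apply: leq_trans (q2 _ _ ij jl) _; rewrite leq_mul2l; lia.
      + by move=> s ? ?; apply: q1; lia.
      + by exists m; split=> //; lia.
    have [||m [? ? ?]] := @geodesic_near_path q L k j i u (ltnW ij) _ _ (between_sym gd bu).
    + apply: leq_trans hk; apply: leq_trans (q2 _ _ (ltnW ij) il) _; rewrite leq_mul2l.
      by rewrite (E (q j)); lia.
    + by move=> s ? ?; apply: q1; lia.
    + by exists m; split=> //; lia.
  by move: (far m ml) (T c u (q m)); lia.
- rewrite /between in bu; case: zor => [h|h].
    move: (T c u z) (E u z) (E z (q j)) ; lia.
  move: (T c u (q j)) (far j jl) bu; rewrite h (gn_refl gd) (E u (q j)); lia.
Qed.

(** Along a geodesic p with the same ends as q, the points near the part of q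
   before m and the points near the part after m cover p.  At the place where the
   first kind stops, two points of q on both sides of m are close to each other,
   so the parameter interval between them is short. *)
Lemma quasi_near_geodesic : exists D1, forall q n, quasi_geodesic q n ->
  forall m, m <= n -> exists2 c, between d (q 0) c (q n) & d (q m) c <= D1.
Proof.
have [D0 hD0] := geodesic_near_quasi.
exists (D0 + L * (L * (2 * D0 + 2))) => q n qg m mn; have [q1 q2] := qg.
have T := gn_tri gd; have E := gn_sym gd.
have [p [p0 pn pS]] := geodesic_path gd (q 0) (q n).
set N := d (q 0) (q n) in pn pS.
have pd i j : i <= j -> j <= N -> d (p i) (p j) = j - i.
  by move=> ij jN; apply: (geodesic_path_dist gd ij jN pS); rewrite p0 pn.
have pb i : i <= N -> between d (q 0) (p i) (q n).
  by move=> iN; rewrite /between -{1}p0 -{1}pn !pd // -/N; lia.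
pose Q t := exists2 i, i <= m & d (p t) (q i) <= D0.
have LL : d (q m) (q m) = 0 by apply: (gn_refl gd).
have key i i' x : i <= m -> m <= i' -> i' <= n -> d (q i) (q i') <= 2 * D0 + 1 ->
    d x (q i) <= D0 -> d (q m) x <= D0 + L * (L * (2 * D0 + 2)).
  move=> im mi' i'n dii' dx.
  have h1 := q2 i i' (leq_trans im mi') i'n.
  have h2 := @path_lipschitz _ _ gd q n i m L im mn q1.
  have h3 : L * (m - i) <= L * (L * (2 * D0 + 2)).
    rewrite leq_mul2l; apply/orP; right.
    apply: leq_trans (_ : i' - i <= _); first by lia.
    by apply: leq_trans h1 _; rewrite leq_mul2l; lia.
  by move: (T (q m) (q i) x) (E (q m) (q i)) (E (q i) x); lia.
have Q0 : Q 0 by exists 0 => //; rewrite p0 (gn_refl gd).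
case: (pselect (Q N)) => [[i im iD]|nQN].
  exists (q n); first by rewrite /between (gn_refl gd) addn0.
  apply: (key i n) => //; last by rewrite -pn.
  by rewrite E -pn; lia.
have [t tN [Qt nQt]] : exists2 t, t < N & Q t /\ ~ Q t.+1.
  apply: contrapT => no; apply: nQN.
  have : N <= N by [].
  elim: {-2}N => [|t IH] tN //.
  apply: contrapT => nQ; apply: no; exists t => //; split=> //.
  by apply: IH; apply: ltnW.
case: Qt => i im iD.
have [i' i'n i'D] := hD0 q n qg _ (pb _ tN).
have mi' : m < i' by rewrite ltnNge; apply/negP => h; apply: nQt; exists i'.
exists (p t); first by apply/pb/ltnW.
apply: (key i i' (p t)) => //; first exact: ltnW.
move: (T (q i) (p t) (q i')) (T (p t) (p t.+1) (q i')) (pS t tN) (E (q i) (p t)); lia.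
Qed.

End Morse.

(** A side of a triangle of X is sent to a quasi-geodesic of Y, hence near a
   geodesic side of a thin triangle, which in turn is near the image of another
   side. *)
Lemma hyp_quasi_isometric (X Y : Type) (dX : X -> X -> nat) (dY : Y -> Y -> nat)
    (f : X -> Y) (L K : nat) :
  geodesic_nat dX -> geodesic_nat dY ->
  (forall x y, dY (f x) (f y) <= L * dX x y) ->
  (forall x y, dX x y <= L * (dY (f x) (f y) + 1)) ->
  hyp_nat dY K -> exists K', hyp_nat dX K'.
Proof.
move=> gX gY f1 f2 /(hyp_thin gY) thinY.
have [D0 hD0] := geodesic_near_quasi gY thinY L.
have [D1 hD1] := quasi_near_geodesic gY thinY L.
set K1 := K + K in thinY.
have qgP p n : (forall i, i < n -> dX (p i) (p i.+1) <= 1) -> dX (p 0) (p n) = n ->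
    quasi_geodesic dY L (f \o p) n.
  move=> pS pn; split=> [i ilt|i j ij jn] /=.
    by apply: leq_trans (f1 _ _) _; rewrite -[leqRHS]muln1 leq_mul2l pS // orbT.
  by rewrite -(geodesic_path_dist gX ij jn pS pn) f2.
have near x y c : between dY (f x) c (f y) ->
    exists2 p, between dX x p y & dY c (f p) <= D0.
  have [p [p0 pn pS]] := geodesic_path gX x y.
  have dpn : dX (p 0) (p (dX x y)) = dX x y by rewrite p0 pn.
  rewrite -{1}p0 -{1}pn => bc.
  have [i ilt iD] := hD0 _ _ (qgP _ _ pS dpn) _ bc.
  exists (p i) => //; rewrite /between -{1}p0 -{1}pn.
  by rewrite !(geodesic_path_dist gX _ _ pS dpn) //; lia.
exists (L * (D1 + K1 + D0 + 1) + L * (D1 + K1 + D0 + 1)).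
apply: (thin_hyp gX) => x y z p bp.
have [r [r0 rc rn rS]] := geodesic_path_through gX bp.
have [||c bc cD] := hD1 (f \o r) (dX x y) _ (dX x p); first by apply: qgP => //; rewrite r0 rn.
  by move: bp; rewrite /between; lia.
rewrite /= r0 rn rc in bc cD.
have [u bu uD] := thinY _ _ (f z) _ bc.
have [v bv vD] : exists2 v, between dX y v z \/ between dX z v x & dY u (f v) <= D0.
  by case: bu => /near[v ? ?]; exists v => //; [left | right].
exists v => //; apply: leq_trans (f2 _ _) _; rewrite leq_mul2l; apply/orP; right.
by move: (gn_tri gY (f p) c (f v)) (gn_tri gY c u (f v)); lia.
Qed.

(** * Graph distances *)

Section Walks.
Variables (T : Type) (e : T -> T -> Prop).

Fixpoint walk n x y : Prop :=
  if n is m.+1 then exists2 z, e x z & walk m z y else x = y.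

Lemma walk_cat m n x y z : walk m x y -> walk n y z -> walk (m + n) x z.
Proof.
elim: m x => [|m IH] x; first by move=> ->.
by case=> u xu uy yz; exists u => //; apply: IH.
Qed.

Lemma walk1 x y : e x y -> walk 1 x y. Proof. by exists y. Qed.

(** The default value 0 is taken between vertices in different components. *)
Definition gdist x y : nat :=
  if pselect (exists n, `[< walk n x y >]) is left h then ex_minn h else 0.

Hypothesis esym : forall x y, e x y -> e y x.
Hypothesis econn : forall x y, exists n, walk n x y.

Lemma walk_sym n x y : walk n x y -> walk n y x.
Proof.
elim: n x y => [|n IH] x y; first by move=> ->.
case=> z xz zy; rewrite -addn1; apply: walk_cat (IH _ _ zy) _.
exact/walk1/esym.
Qed.

Lemma gdistP x y : walk (gdist x y) x y /\ forall n, walk n x y -> gdist x y <= n.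
Proof.
rewrite /gdist; case: pselect => [h|[]]; last first.
  by have [n xy] := econn x y; exists n; apply/asboolP.
case: ex_minnP => m /asboolP hm hmin; split=> // n hn.
by apply: hmin; apply/asboolP.
Qed.

Lemma gdist_walk x y : walk (gdist x y) x y. Proof. by case: (gdistP x y). Qed.

Lemma gdist_le n x y : walk n x y -> gdist x y <= n.
Proof. by case: (gdistP x y) => _; apply. Qed.

Lemma gdist_geodesic : geodesic_nat gdist.
Proof.
split.
- by move=> x; apply/eqP; rewrite -leqn0; apply: gdist_le.
- by move=> x y xy; have := gdist_walk x y; rewrite xy.
- by move=> x y; apply/eqP; rewrite eqn_leq !gdist_le //; apply/walk_sym/gdist_walk.
- by move=> x y z; apply/gdist_le/walk_cat; apply: gdist_walk.
- move=> x y k kd.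
  have [c xc cy] : exists2 c, walk k x c & walk (gdist x y - k) c y.
    have := gdist_walk x y; rewrite -{1}(subnKC kd).
    move: (gdist x y - k) => m.
    elim: k x {kd} => [|k IH] x; first by exists x.
    by case=> z xz /IH[c zc cy]; exists c => //; exists z.
  have := gdist_le xc; have := gdist_le cy.
  have := gdist_le (walk_cat (gdist_walk x c) (gdist_walk c y)).
  move=> h1 h2 h3; exists c; last (rewrite /between; lia).
  lia.
Qed.

Lemma gdist_lipschitz (Y : Type) (d : Y -> Y -> nat) (f : T -> Y) L :
  geodesic_nat d -> (forall x y, e x y -> d (f x) (f y) <= L) ->
  forall x y, d (f x) (f y) <= L * gdist x y.
Proof.
move=> gd fL x y; have := gdist_walk x y.
move: (gdist x y) => n; elim: n x => [|n IH] x; first by move=> ->; rewrite (gn_refl gd).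
case=> z xz /IH h; apply: leq_trans (gn_tri gd _ (f z) _) _.
by rewrite mulnS leq_add // fL.
Qed.

End Walks.

(** * Hyperbolic geodesic metric spaces *)

Import Order.TTheory GRing.Theory Num.Theory.
Local Open Scope ring_scope.
Local Open Scope classical_set_scope.

Section RealHyperbolicity.
Variables (R : realType) (X : Type) (d : X -> X -> R).
Hypothesis dM : is_metric d.

Lemma lipschitz_isometric (L : R) (c : R -> X) : d (c 0) (c L) = L ->
  (forall s t, 0 <= s -> s <= t -> t <= L -> d (c s) (c t) <= t - s) ->
  forall s t, 0 <= s <= L -> 0 <= t <= L -> d (c s) (c t) = `|s - t|.
Proof.
have [_ _ dS dT] := dM => cL cLip.
have main s t : 0 <= s -> s <= t -> t <= L -> d (c s) (c t) = t - s.
  move=> s0 st tL.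
  have := cLip 0 s (lexx _) s0 (le_trans st tL).
  have := cLip t L (le_trans s0 st) tL (lexx _).
  have := cLip s t s0 st tL.
  have := dT (c 0) (c s) (c L); have := dT (c s) (c t) (c L).
  by rewrite cL; lra.
move=> s t /andP[s0 sL] /andP[t0 tL]; case: (leP s t) => st.
  by rewrite main // ler0_norm ?opprB // subr_le0.
by rewrite dS main ?(ltW st) // gtr0_norm // subr_gt0.
Qed.

Lemma segment_between x y A : geodesic_segment d x y A ->
  forall Q, A Q -> d x Q + d Q y = d x y.
Proof.
move=> [L [c [L0 <- <- cI ->]]] _ /= [t /andP[t0 tL] <-].
rewrite !cI ?lexx ?L0 ?t0 ?tL //.
by rewrite !sub0r !normrN (ger0_norm t0) (ger0_norm L0) ler0_norm ?subr_le0 //; lra.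
Qed.

Lemma segment_concat x c y : (exists A, geodesic_segment d x c A) ->
  (exists B, geodesic_segment d c y B) -> d x c + d c y = d x y ->
  exists2 A, geodesic_segment d x y A & A c.
Proof.
have [d0 dE dS dT] := dM.
move=> [A [L [f [L0 f0 fL fI _]]]] [B [M [g [M0 g0 gM gI _]]]] xcy.
pose h s := if s <= L then f s else g (s - L).
have dxc : d x c = L by rewrite -f0 -fL fI ?lexx ?L0 // sub0r normrN ger0_norm.
have dcy : d c y = M by rewrite -g0 -gM gI ?lexx ?M0 // sub0r normrN ger0_norm.
have h0 : h 0 = x by rewrite /h L0.
have hLc : h L = c by rewrite /h lexx.
have hM : h (L + M) = y.
  rewrite /h; case: ifPn => [LM|_]; last by rewrite addrC addKr.
  have M00 : M = 0 by lra.
  by rewrite M00 addr0 fL -gM M00 g0.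
exists (h @` [set t | 0 <= t <= L + M]); last first.
  by exists L => //=; rewrite L0 lerDl.
exists (L + M), h; split=> //; first exact: addr_ge0.
apply: lipschitz_isometric; first by rewrite h0 hM -xcy dxc dcy.
have hl s t : 0 <= s -> s <= t -> t <= L -> d (h s) (h t) <= t - s.
  move=> s0 st tL; rewrite /h tL (le_trans st tL) fI ?s0 ?tL ?(le_trans st tL) ?(le_trans s0 st) //.
  by rewrite ler0_norm ?subr_le0 // opprB.
have hr s t : L <= s -> s <= t -> t <= L + M -> d (h s) (h t) <= t - s.
  move=> Ls st tL.
  have hE r : L <= r -> h r = g (r - L).
    rewrite le_eqVlt => /orP[/eqP <-|Lr]; first by rewrite hLc subrr g0.
    by rewrite /h leNgt Lr.
  rewrite !hE ?(le_trans Ls) // gI; first by rewrite ler0_norm; lra.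
    by apply/andP; split; lra.
  by apply/andP; split; lra.
move=> s t s0 st tL; case: (leP t L) => tL'; first exact: hl.
case: (leP s L) => sL; last by apply: hr => //; apply: ltW.
apply: le_trans (dT _ (h L) _) _.
by have := hl s L s0 sL (lexx _); have := hr L t (lexx _) (ltW tL') tL; lra.
Qed.

(** The analogue of [hyp_nat] for a real-valued distance. *)
Definition hyp_real K := forall x y c z, d x c + d c y = d x y ->
  d z c + d x c <= d x z + K \/ d z c + d y c <= d y z + K.

Lemma thin_hyp_real delta : geodesic_space d -> delta_hyperbolic d delta ->
  hyp_real (delta + delta).
Proof.
have [d0 dE dS dT] := dM => dG dH x y c z xcy.
have [A sA Ac] := segment_concat (dG x c) (dG c y) xcy.
have [B sB] := dG y z; have [C sC] := dG z x.
have [Q [BQ|CQ] cQ] := dH _ _ _ _ _ _ sA sB sC c Ac; [right|left].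
- have := segment_between sB BQ; have := dT z Q c; have := dT y Q c.
  by rewrite (dS Q c) (dS z Q); lra.
- have := segment_between sC CQ; have := dT z Q c; have := dT x Q c.
  by rewrite (dS Q c) (dS x Q) (dS x z); lra.
Qed.

Lemma segment_point x y A : geodesic_segment d x y A -> forall t, 0 <= t ->
  exists2 Q, A Q & d x Q = Num.min t (d x y).
Proof.
move=> [L [c [L0 <- <- cI ->]]] t t0.
have dL : d (c 0) (c L) = L by rewrite cI ?lexx ?L0 // sub0r normrN ger0_norm.
have mL : 0 <= Num.min t L <= L by rewrite le_min t0 L0 ge_min lexx orbT.
exists (c (Num.min t L)); first by exists (Num.min t L).
by rewrite dL cI ?lexx ?L0 // sub0r normrN ger0_norm //; case/andP: mL.
Qed.

Lemma segment_sym x y A : geodesic_segment d x y A -> geodesic_segment d y x A.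
Proof.
move=> [L [c [L0 c0 cL cI ->]]]; exists L, (fun t => c (L - t)).
split=> //; rewrite ?subr0 ?subrr //.
  move=> s t /andP[s0 sL] /andP[t0 tL].
  rewrite cI; last 2 first.
    by apply/andP; split; lra.
  by apply/andP; split; lra.
  by rewrite distrC; congr (`| _ |); lra.
apply/seteqP; split=> _ /= [t /andP[t0 tL] <-].
  exists (L - t); first by apply/andP; split; lra.
  by congr c; lra.
by exists (L - t) => //; apply/andP; split; lra.
Qed.

(** If P almost lies between x and z, then it is close to the point Q of the side
   from x to z at distance d(x,P) from x (or to z when d(x,P) exceeds d(x,z)), by
   [hyp_real] applied to Q with third vertex P. *)
Lemma hyp_thin_real K : hyp_real K -> delta_hyperbolic d (K + K).
Proof.
have [d0 dE dS dT] := dM => dH.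
have key x z P A : geodesic_segment d x z A -> d z P + d x P <= d x z + K ->
    exists2 Q, A Q & d P Q <= K + K.
  move=> sA h; have [Q AQ xQ] := segment_point sA (d0 x P).
  exists Q => //; have xQz := segment_between sA AQ.
  (* Take all four points of the inequality equal. *)
  have K0 : 0 <= K.
    by have dxx : d x x = 0 by [apply/dE]; have := dH x x x x; rewrite dxx; lra.
  have := dH _ _ _ P xQz; rewrite (dS z Q) xQ.
  case: (leP (d x P) (d x z)) xQ => hm xQ; have := d0 z P; rewrite (dS P Q); lra.
move=> x y z A B C sA sB sC P AP.
case: (dH _ _ _ z (segment_between sA AP)) => h.
  by have [Q CQ dQ] := key _ _ _ _ (segment_sym sC) h; exists Q => //; right.
by have [Q CQ dQ] := key _ _ _ _ sB h; exists Q => //; left.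
Qed.

End RealHyperbolicity.

(** * Realizations of graphs *)

Lemma seq_min_exists (R : realDomainType) (s : seq R) (P : R -> Prop) :
  (exists2 l, l \in s & P l) ->
  exists2 l, P l & forall l', l' \in s -> P l' -> l <= l'.
Proof.
elim: s => [[]//|a s IH] [l ls Pl].
case: (pselect (exists2 l', l' \in s & P l')) => [/IH [m Pm mmin]|no].
  case: (pselect (P a)) => Pa; last first.
    exists m => // l'; rewrite inE => /predU1P[->//|]; exact: mmin.
  case: (leP a m) => am.
    exists a => // l'; rewrite inE => /predU1P[->//|l's Pl'].
    exact: le_trans am (mmin _ l's Pl').
  exists m => // l'; rewrite inE => /predU1P[->|]; last exact: mmin.
  by move=> _; apply: ltW.
exists l => // l' l's' Pl'.
have eqa m : m \in a :: s -> P m -> m = a.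
  by rewrite inE => /predU1P[//|ms] Pm; case: no; exists m.
by rewrite (eqa l) // (eqa l').
Qed.

Section MetricGraphTheory.
Variables (R : realType) (V : eqType) (adj : V -> V -> Prop).
Hypothesis asym : forall x y, adj x y -> adj y x.
Hypothesis airr : forall x y, adj x y -> x != y.
Hypothesis aconn : forall x y, exists n, walk adj n x y.

Local Notation point := (graph_point R adj).
Local Notation D := (gdist adj).
Local Notation gd := (@graph_dist R V adj).
Local Notation path := (@pl_path R V adj).
Implicit Types (u v w a b : V) (x y z : point).

Lemma cell_sym v w : cell adj v w -> cell adj w v.
Proof. by case=> [->|/asym]; [left | right]. Qed.

Lemma edge_pointE v w (t : R) u :
  edge_point v w t u = (1 - t) * (u == v)%:R + t * (u == w)%:R.
Proof. by []. Qed.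

Lemma on_cell_sym v w (f : V -> R) : on_cell v w f -> on_cell w v f.
Proof.
move=> [t /andP[t0 t1] ->]; exists (1 - t); first by apply/andP; split; lra.
by apply/funext => u; rewrite !edge_pointE; lra.
Qed.

Lemma on_cell_sum v w (f : V -> R) u : on_cell v w f ->
  [/\ 0 <= f u <= 1, v != w -> f v + f w = 1, v = w -> f v = 1
    & u != v -> u != w -> f u = 0].
Proof.
move=> [t /andP[t0 t1] ->]; rewrite !edge_pointE; split.
- by case: (u == v); case: (u == w); rewrite ?mulr1 ?mulr0; apply/andP; split; lra.
- by move=> vw; rewrite (eq_sym w v) !eqxx (negbTE vw) /=; lra.
- by move=> ->; rewrite !eqxx /=; lra.
- by move=> /negbTE-> /negbTE->; rewrite !mulr0 addr0.
Qed.

Lemma on_cell_inj v w (f g : V -> R) :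
  on_cell v w f -> on_cell v w g -> f v = g v -> f = g.
Proof.
move=> [t _ ->] [s _ ->]; have [->|vw] := eqVneq v w.
  by move=> _; apply/funext => u; rewrite !edge_pointE; lra.
rewrite !edge_pointE eqxx (negbTE vw) !mulr0 !mulr1 => E.
by have -> : t = s by lra.
Qed.

Lemma cell_diff_sym v w (f g : V -> R) :
  on_cell v w f -> on_cell v w g -> `|f v - g v| = `|f w - g w|.
Proof.
move=> Hf Hg; have [->//|vw] := eqVneq v w.
have [_ /(_ vw) hf _ _] := on_cell_sum v Hf.
have [_ /(_ vw) hg _ _] := on_cell_sum v Hg.
by rewrite distrC; congr (`| _ |); lra.
Qed.

Lemma on_vertex v w : @on_cell R V v w (edge_point v v 0).
Proof. by exists 0; [rewrite lexx ler01 | apply/funext => u; rewrite !edge_pointE; lra]. Qed.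

Definition vx u : point :=
  exist _ (edge_point u u 0) (ex_intro _ u (ex_intro _ u (conj (or_introl erefl) (on_vertex u u)))).

Lemma vxE u v : sval (vx u) v = (v == u)%:R.
Proof. by rewrite /= edge_pointE; lra. Qed.

Lemma on_cell_vertex v w (f : V -> R) u : on_cell v w f -> f u = 1 ->
  (u = v \/ u = w) /\ f = edge_point u u 0.
Proof.
move=> Hf fu.
have uvw : u = v \/ u = w.
  have [_ _ _ h] := on_cell_sum u Hf.
  have [->|uv] := eqVneq u v; first by left.
  have [->|uw] := eqVneq u w; first by right.
  by move: (h uv uw); rewrite fu => /eqP; rewrite oner_eq0.
split=> //.
have vE : edge_point u u 0 u = 1 :> R by rewrite edge_pointE eqxx mul0r addr0 subr0 mulr1.
case: uvw => E; subst u.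
  by apply: (on_cell_inj Hf); [exact: on_vertex | rewrite vE].
by apply: (on_cell_inj (on_cell_sym Hf)); [exact: on_vertex | rewrite vE].
Qed.

Lemma on_cell_cases v w (f : V -> R) : on_cell v w f ->
  (exists2 u, u = v \/ u = w & f u = 1) \/ (0 < f v < 1 /\ v != w).
Proof.
move=> Hf; have [/andP[f0 f1] h1 h2 _] := on_cell_sum v Hf.
have [vw|vw] := eqVneq v w; first by left; exists v; [left | exact: h2].
have [E|n1] := eqVneq (f v) 1; first by left; exists v; [left |].
have [E|n0] := eqVneq (f v) 0.
  by left; exists w; [right | move: (h1 vw); rewrite E add0r].
by right; split=> //; rewrite !lt_neqAle f0 f1 n1 eq_sym n0.
Qed.

Lemma interior_cell v w v' w' (f : V -> R) : on_cell v w f -> 0 < f v < 1 ->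
  v != w -> on_cell v' w' f -> (v' = v /\ w' = w) \/ (v' = w /\ w' = v).
Proof.
move=> Hf /andP[f0 f1] vw Hf'.
have [_ /(_ vw) hs _ _] := on_cell_sum v Hf.
have [_ _ _ hv] := on_cell_sum v Hf'.
have [_ _ _ hw] := on_cell_sum w Hf'.
have vin : v = v' \/ v = w'.
  have [->|n1] := eqVneq v v'; first by left.
  have [->|n2] := eqVneq v w'; first by right.
  by exfalso; move: (hv n1 n2); lra.
have win : w = v' \/ w = w'.
  have [->|n1] := eqVneq w v'; first by left.
  have [->|n2] := eqVneq w w'; first by right.
  by exfalso; move: (hw n1 n2); lra.
by case: vin win => Ev [] Ew; move: vw; rewrite Ev Ew ?eqxx //; [left | right].
Qed.

Lemma point_eq x y : sval x = sval y -> x = y.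
Proof.
case: x y => [f p] [g q] /= E; subst g.
by congr exist; apply: Prop_irrelevance.
Qed.

Lemma pl_path_step v w x y : cell adj v w -> on_cell v w (sval x) ->
  on_cell v w (sval y) -> path x y `|sval x v - sval y v|.
Proof.
move=> c ox oy; rewrite -[X in path _ _ X]addr0.
exact: pl_path_cons c ox oy (pl_path_nil _).
Qed.

Lemma pl_path_cat x y z l m : path x y l -> path y z m -> path x z (l + m).
Proof.
elim=> [a|a b c v w k vw oa ob bc IH] yz; first by rewrite add0r.
by rewrite -addrA; apply: pl_path_cons vw oa ob (IH yz).
Qed.

Lemma pl_path_sym x y l : path x y l -> path y x l.
Proof.
elim=> [a|a b c v w k vw oa ob bc IH]; first exact: pl_path_nil.
by rewrite addrC; apply: pl_path_cat IH _; rewrite distrC; exact: pl_path_step vw ob oa.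
Qed.

Lemma pl_path_ge0 x y l : path x y l -> 0 <= l.
Proof. by elim=> [x0|x0 y0 z0 p q k _ _ _ _ k0]; rewrite ?lexx ?addr_ge0. Qed.

Definition cell_end a x := exists a', cell adj a a' /\ on_cell a a' (sval x).

(** The two shapes of a candidate for a shortest path: inside a single cell, or
   through an end a of a cell of x, an edge path from a to b, and an end b of a
   cell of y.  On a cell, the distance from x to its end a is 1 - x a. *)
Inductive canonical x y : R -> Prop :=
| CanonicalCell v w : cell adj v w -> on_cell v w (sval x) ->
    on_cell v w (sval y) -> canonical x y `|sval x v - sval y v|
| CanonicalFar a b n : cell_end a x -> cell_end b y -> walk adj n a b ->
    canonical x y (1 - sval x a + n%:R + (1 - sval y b)).

Lemma cell_end_path a x : cell_end a x -> path x (vx a) (1 - sval x a).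
Proof.
case=> a' [ca oa].
have -> : 1 - sval x a = `|sval x a - sval (vx a) a|.
  have [/andP[_ x1] _ _ _] := on_cell_sum a oa.
  by rewrite vxE eqxx distrC ger0_norm // subr_ge0.
by apply: pl_path_step oa _ => //; apply: on_vertex.
Qed.

Lemma walk_path n a b : walk adj n a b -> path (vx a) (vx b) n%:R.
Proof.
elim: n a => [|n IH] a; first by move=> <-; exact: pl_path_nil.
case=> c ac /IH; rewrite -addn1 natrD addrC; apply: pl_path_cat.
have -> : 1%:R = `|sval (vx a) a - sval (vx c) a| :> R.
  by rewrite !vxE eqxx (negbTE (airr ac)) subr0 normr1.
apply: (@pl_path_step a c); [by right | exact: on_vertex |].
exact/on_cell_sym/on_vertex.
Qed.

Lemma canonical_path x y l : canonical x y l -> path x y l.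
Proof.
case=> [v w c ox oy|a b n nx ny ab]; first exact: pl_path_step c ox oy.
apply: pl_path_cat (pl_path_sym (cell_end_path ny)).
exact: pl_path_cat (cell_end_path nx) (walk_path ab).
Qed.

Lemma cell_end_vertex a u : cell_end a (vx u) -> a = u \/ adj u a /\ sval (vx u) a = 0.
Proof.
case=> a' [ca oa].
have [->|au] := eqVneq a u; first by left.
have [|[E|E] _] := on_cell_vertex oa (u := u); first by rewrite vxE eqxx.
  by rewrite E eqxx in au.
right; rewrite vxE (negbTE au); split=> //; subst u.
by case: ca => [E|/asym//]; rewrite E eqxx in au.
Qed.

(** By induction on the path, whose first step from x to y stays in one cell: if y
   is a vertex, this step ends at a vertex and the candidate for the rest of the
   path is prolonged; if y is interior to an edge, this edge is the only cell
   containing y, and the triangle inequality on it absorbs the step. *)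
Lemma canonical_shorter x y l : path x y l -> exists2 m, m <= l & canonical x y m.
Proof.
elim=> {x y l} [x|x y z v w l c ox oy yz [m ml Cm]].
  case: (svalP x) => v [w [c o]].
  by exists `|sval x v - sval x v|; [rewrite subrr normr0 | exact: (CanonicalCell c o o)].
have [[u uvw yu]|[y01 vw]] := on_cell_cases oy.
  have [u' [cu ou ouy E]] : exists u', [/\ cell adj u u', on_cell u u' (sval x),
      on_cell u u' (sval y) & `|sval x v - sval y v| = 1 - sval x u].
    have E : `|sval x u - sval y u| = 1 - sval x u.
      have [/andP[_ x1] _ _ _] := on_cell_sum u ox.
      by rewrite yu distrC ger0_norm // subr_ge0.
    case: uvw => ?; subst u.
      by exists w.
    exists v; rewrite (cell_diff_sym ox oy) E.
    by split; [exact: cell_sym | exact: on_cell_sym | exact: on_cell_sym |].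
  have nx : cell_end u x by exists u'.
  have yE : y = vx u.
    by apply: point_eq; have [_ ->] := on_cell_vertex oy yu.
  rewrite E; case: Cm ml => [p q cpq op oq|a b n na nb ab] ml.
    exists (1 - sval x u + 0%:R + (1 - sval z u)); last first.
      apply: CanonicalFar => //; have [[->|->] _] := on_cell_vertex op yu; first by exists q.
      by exists p; split; [exact: cell_sym | exact: on_cell_sym].
    have [/andP[_ z1] _ _ _] := on_cell_sum u oq.
    have -> : 1 - sval z u = `|sval y p - sval z p|.
      have <- : `|sval y u - sval z u| = 1 - sval z u by rewrite yu ger0_norm // subr_ge0.
      have [[->|->] _] := on_cell_vertex op yu => //.
      by rewrite (cell_diff_sym op oq).
    by lra.
  rewrite yE in na.
  have [E'|[ua ya]] := cell_end_vertex na.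
    subst a; exists (1 - sval x u + n%:R + (1 - sval z b)); last exact: CanonicalFar.
    by rewrite yu in ml; lra.
  exists (1 - sval x u + n.+1%:R + (1 - sval z b)).
    by rewrite -yE in ya; rewrite ya in ml; rewrite -natr1; lra.
  by apply: CanonicalFar => //; exists a.
case: Cm ml => [p q cpq op oq|a b n [a' [ca oa]] nb ab] ml.
  have ozE : on_cell v w (sval z) /\ `|sval y p - sval z p| = `|sval y v - sval z v|.
    have [[? ?]|[? ?]] := interior_cell oy y01 vw op; subst p q => //.
    by split; [exact: on_cell_sym | exact: cell_diff_sym].
  case: ozE => oz E; exists `|sval x v - sval z v|; last exact: CanonicalCell c ox oz.
  by rewrite E in ml; have := ler_distD (sval y v) (sval x v) (sval z v); lra.
have [oax E] : on_cell a a' (sval x) /\ `|sval x v - sval y v| = `|sval x a - sval y a|.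
  have [[? ?]|[? ?]] := interior_cell oy y01 vw oa; subst a a' => //.
  by split; [exact: on_cell_sym | exact: cell_diff_sym].
exists (1 - sval x a + n%:R + (1 - sval z b)); last by apply: CanonicalFar => //; exists a'.
by rewrite E; have := ler_norm (sval y a - sval x a); rewrite distrC; lra.
Qed.

(** The coordinates of x and y take finitely many values, so the canonical paths
   below a given length have finitely many lengths. *)
Lemma shortest_path x y : exists2 l, path x y l & forall m, path x y m -> l <= m.
Proof.
case: (svalP x) => v [w [cx ox]]; case: (svalP y) => v' [w' [cy oy]].
have [n vv'] := aconn v v'.
have nx : cell_end v x by exists w.
have ny : cell_end v' y by exists w'.
have C0 : canonical x y (1 - sval x v + n%:R + (1 - sval y v')) by exact: CanonicalFar.
set l0 := (X in canonical x y X) in C0.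
have coord (f : V -> R) p q : on_cell p q f -> exists s : seq R, forall u, f u \in s.
  move=> [t _ ->]; exists [:: 0; t; 1 - t; 1] => u; rewrite edge_pointE !inE.
  by case: (u == p); case: (u == q); rewrite ?mulr1 ?mulr0 ?addr0 ?add0r ?subrK ?eqxx ?orbT.
have [sx xs] := coord _ _ _ ox; have [sy ys] := coord _ _ _ oy.
have [N Nl0] : exists N : nat, l0 < N%:R.
  by exists (Num.bound l0); apply: archi_boundP; apply: pl_path_ge0 (canonical_path C0).
pose s1 := [seq `|p - q| | p <- sx, q <- sy].
pose s2 := [seq 1 - p.1 + k%:R + (1 - p.2) | p <- [seq (p, q) | p <- sx, q <- sy], k <- iota 0 N].
have ins m : m <= l0 -> canonical x y m -> m \in s1 ++ s2.
  move=> ml Cm; case: Cm ml => [p q c op oq|a b k na nb ab] ml; rewrite mem_cat.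
    by apply/orP; left; apply/allpairsP; exists (sval x p, sval y p); split=> /=.
  apply/orP; right; apply/allpairsP; exists ((sval x a, sval y b), k); split=> //=.
    by apply/allpairsP; exists (sval x a, sval y b); split=> /=.
  rewrite mem_iota add0n /= -(ltr_nat R).
  apply: le_lt_trans Nl0.
  case: na => a' [_ /(on_cell_sum a) [/andP[_ xa] _ _ _]].
  case: nb => b' [_ /(on_cell_sum b) [/andP[_ yb] _ _ _]].
  lra.
have [|l Cl lmin] := @seq_min_exists _ (s1 ++ s2) (canonical x y).
  by exists l0 => //; apply: ins.
exists l; first exact: canonical_path.
move=> m /canonical_shorter[m' m'm Cm']; apply: le_trans m'm.
case: (leP m' l0) => h; first by apply: lmin => //; apply: ins.
apply: le_trans (ltW h); apply: lmin => //; exact: ins.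
Qed.

Lemma graph_distP x y : path x y (gd x y) /\ forall m, path x y m -> gd x y <= m.
Proof.
have [l xy lmin] := shortest_path x y.
suff -> : gd x y = l by [].
apply/eqP; rewrite eq_le; apply/andP; split.
  by apply: ge_inf => //; exists l.
by apply: lb_le_inf => //; exists l.
Qed.

Lemma graph_dist_path x y : path x y (gd x y). Proof. by case: (graph_distP x y). Qed.

Lemma graph_dist_le x y m : path x y m -> gd x y <= m.
Proof. by case: (graph_distP x y) => _; apply. Qed.

Lemma graph_dist_metric : is_metric gd.
Proof.
have g0 x y : 0 <= gd x y by apply: pl_path_ge0 (graph_dist_path x y).
have gs x y : gd x y <= gd y x by apply/graph_dist_le/pl_path_sym/graph_dist_path.
split=> //.
- move=> x y; split=> [E|->]; last first.
    by apply/eqP; rewrite eq_le g0 andbT; apply: graph_dist_le; exact: pl_path_nil.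
  have := graph_dist_path x y; rewrite E.
  have [m m0] : exists m : R, m = 0 by exists 0.
  rewrite -[X in path _ _ X]m0 => xy; elim: xy m0 => // {E}.
  move=> a b c v w l cvw oa ob bc IH E.
  have l0 := pl_path_ge0 bc; have n0 := normr_ge0 (sval a v - sval b v).
  rewrite -IH; last by lra.
  apply: point_eq; apply: on_cell_inj oa ob _; apply/eqP; rewrite -subr_eq0 -normr_eq0.
  by apply/eqP; lra.
- by move=> x y; apply/eqP; rewrite eq_le !gs.
- by move=> x y z; apply: graph_dist_le; apply: pl_path_cat; exact: graph_dist_path.
Qed.

Lemma cell_segment v w x y : cell adj v w -> on_cell v w (sval x) ->
  on_cell v w (sval y) -> gd x y = `|sval x v - sval y v| ->
  exists A, geodesic_segment gd x y A.
Proof.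
move=> c ox oy dE.
have : sval x v <= sval y v \/ sval y v <= sval x v by case: (leP (sval x v) (sval y v)) => ?; [left|right; apply: ltW].
wlog xy : x y ox oy dE / sval y v <= sval x v.
  move=> H [h|h]; last by apply: H => //; right.
  have [_ _ dS _] := graph_dist_metric.
  have [||A sA] := H y x oy ox _ h; [by rewrite dS distrC | by right |].
  by exists A; apply: segment_sym.
move=> _; have L0 : 0 <= sval x v - sval y v by lra.
rewrite ger0_norm // in dE; set L := sval x v - sval y v in L0 dE.
have [/andP[_ x1] xs xv _] := on_cell_sum v ox.
have [/andP[y0 _] ys yv _] := on_cell_sum v oy.
have pt t : 0 <= t <= L -> exists z, on_cell v w (sval z) /\
    (sval z v = sval x v - t /\ (t = 0 -> z = x) /\ (t = L -> z = y)).
  move=> /andP[t0 tL].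
  have [vw|vw] := eqVneq v w.
    have L00 : L = 0 by rewrite /L xv // yv // subrr.
    have xyE : x = y by apply: point_eq; apply: (on_cell_inj ox oy); rewrite xv // yv.
    by exists x; split=> //; split; [lra | split].
  have og : on_cell v w (edge_point v w (1 - (sval x v - t))).
    by exists (1 - (sval x v - t)) => //; apply/andP; split; move: tL; rewrite /L; lra.
  have E : edge_point v w (1 - (sval x v - t)) v = sval x v - t.
    by rewrite edge_pointE eqxx (negbTE vw) mulr1 mulr0; lra.
  exists (exist _ _ (ex_intro _ v (ex_intro _ w (conj c og)))); split=> //; split=> //.
  split=> tE; apply: point_eq => /=.
    by apply: (on_cell_inj og ox); rewrite E tE subr0.
  by apply: (on_cell_inj og oy); rewrite E tE /L; lra.
have [f hf] : {f : R -> point & forall t, 0 <= t <= L -> on_cell v w (sval (f t)) /\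
    (sval (f t) v = sval x v - t /\ (t = 0 -> f t = x) /\ (t = L -> f t = y))}.
  apply: (@choice _ _ (fun t z => 0 <= t <= L -> on_cell v w (sval z) /\
    (sval z v = sval x v - t /\ (t = 0 -> z = x) /\ (t = L -> z = y)))) => t.
  case: (pselect (0 <= t <= L)) => [/pt[z hz]|no]; first by exists z.
  by exists x.
have f0 : f 0 = x by have [|_ [_ [h _]]] := hf 0; [rewrite lexx L0 | exact: h].
have fL : f L = y by have [|_ [_ [_ h]]] := hf L; [rewrite lexx L0 | exact: h].
exists (f @` [set t | 0 <= t <= L]), L, f; split=> //.
apply: (lipschitz_isometric graph_dist_metric); first by rewrite f0 fL.
move=> s t s0 st tL.
have [|os [Es _]] := hf s; first by apply/andP; split; lra.
have [|ot [Et _]] := hf t; first by apply/andP; split; lra.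
apply: le_trans (graph_dist_le (pl_path_step c os ot)) _.
by rewrite Es Et ger0_norm; lra.
Qed.

(** A shortest path is a concatenation of steps in cells, each of which is
   shortest. *)
Lemma graph_dist_geodesic : geodesic_space gd.
Proof.
have M := graph_dist_metric; have [d0 dE dS dT] := M.
move=> x y; have := graph_dist_path x y.
suff main l : path x y l -> l = gd x y -> exists A, geodesic_segment gd x y A by move=> /main; apply.
elim=> {x y l} [x _|x y z v w l c ox oy yz IH E].
  have xx : gd x x = 0 by apply/dE.
  exists [set x], 0, (fun=> x); split=> //.
    by move=> s t /andP[s0 s1] /andP[t0 t1]; rewrite xx; have -> : s = t by [lra]; rewrite subrr normr0.
  by apply/seteqP; split=> [_ -> /=|_ [_ _ <-] //]; exists 0; rewrite ?lexx.
have h1 := graph_dist_le (pl_path_step c ox oy).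
have h2 := graph_dist_le yz; have h3 := dT x y z.
have [|||A sA _] := segment_concat M (x := x) (c := y) (y := z); last by exists A.
- by apply: cell_segment c ox oy _; lra.
- by apply: IH; lra.
- by lra.
Qed.

Lemma cell_end_dist a u : cell_end a (vx u) -> (D u a)%:R <= 1 - sval (vx u) a.
Proof.
move=> /cell_end_vertex[->|[ua ->]].
  by rewrite vxE eqxx subrr (gn_refl (gdist_geodesic asym aconn)).
by rewrite subr0 -[1]/(1%:R) ler_nat; apply: gdist_le => //; apply: walk1.
Qed.

Lemma graph_dist_vertex u v : gd (vx u) (vx v) = (D u v)%:R.
Proof.
have gD := gdist_geodesic asym aconn.
apply/eqP; rewrite eq_le; apply/andP; split.
  by apply/graph_dist_le/walk_path/gdist_walk.
have [l ld Cl] := canonical_shorter (graph_dist_path (vx u) (vx v)).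
apply: le_trans ld; case: Cl => [p q c ou ov|a b n na nb ab].
  have key p' q' : cell adj p' q' -> on_cell p' q' (sval (vx v)) -> u = p' ->
      (D u v)%:R <= `|sval (vx u) p' - sval (vx v) p'|.
    move=> c' ov' E; subst p'; rewrite (gn_sym gD) [sval (vx u) u]vxE eqxx.
    apply: le_trans (ler_norm _); apply: cell_end_dist; by exists q'.
  have [|[E|E] _] := on_cell_vertex ou (u := u); first by rewrite vxE eqxx.
    exact: key c ov E.
  by rewrite (cell_diff_sym ou ov); apply: key (cell_sym c) (on_cell_sym ov) E.
have := cell_end_dist na; have := cell_end_dist nb; have := gdist_le aconn ab.
have := gn_tri gD u a v; have := gn_tri gD a b v.
rewrite -!(ler_nat R) !natrD (gn_sym gD v b); lra.
Qed.

Lemma near_some_vertex x : exists u, gd x (vx u) <= 1.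
Proof.
case: (svalP x) => v [w [c o]]; exists v.
have nv : cell_end v x by exists w.
apply: le_trans (graph_dist_le (cell_end_path nv)) _.
by have [/andP[x0 _] _ _ _] := on_cell_sum v o; lra.
Qed.

(** Every point is at distance at most 1 from a vertex.  Replacing four points by
   vertices, betweenness is lost by at most 6, which [hyp_almost_between]
   tolerates. *)
Lemma hyp_real_of_nat K : hyp_nat D K -> hyp_real gd (3 * K + 18)%:R.
Proof.
have gD := gdist_geodesic asym aconn; have [d0 dE dS dT] := graph_dist_metric.
move=> hK x y c z xcy.
have [x' hx] := near_some_vertex x; have [y' hy] := near_some_vertex y.
have [c' hc] := near_some_vertex c; have [z' hz] := near_some_vertex z.
have app p q p' q' : gd p (vx p') <= 1 -> gd q (vx q') <= 1 ->
    gd p q <= (D p' q')%:R + 2 /\ (D p' q')%:R <= gd p q + 2.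
  move=> hp hq; rewrite -graph_dist_vertex.
  have := dT p (vx p') q; have := dT (vx p') (vx q') q.
  have := dT (vx p') p (vx q'); have := dT p q (vx q').
  by rewrite (dS (vx p') p) (dS (vx q') q); split; lra.
have [xc1 xc2] := app _ _ _ _ hx hc; have [cy1 cy2] := app _ _ _ _ hc hy.
have [xy1 xy2] := app _ _ _ _ hx hy; have [zc1 zc2] := app _ _ _ _ hz hc.
have [xz1 xz2] := app _ _ _ _ hx hz; have [yz1 yz2] := app _ _ _ _ hy hz.
have [yc1 yc2] := app _ _ _ _ hy hc.
have e6 : (D x' c' + D c' y' <= D x' y' + 6)%N.
  by rewrite -(ler_nat R) !natrD; lra.
by case: (hyp_almost_between gD hK z' e6); rewrite -(ler_nat R) !natrD !natrM => h;
  [left|right]; lra.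
Qed.

Lemma hyp_nat_of_real K : hyp_real gd K -> exists K', hyp_nat D K'.
Proof.
have [d0 dE dS dT] := graph_dist_metric => hK.
have [N KN] : exists N : nat, K <= N%:R.
  exists (Num.bound `|K|); apply: le_trans (ler_norm _) _.
  by apply: ltW; apply: archi_boundP.
exists N => x y c z bc.
have := hK (vx x) (vx y) (vx c) (vx z); rewrite !graph_dist_vertex -natrD bc.
by case=> // h; [left|right]; rewrite -(ler_nat R) !natrD; lra.
Qed.

Lemma hyperbolic_graphP : hyperbolic_space gd <-> exists K, hyp_nat D K.
Proof.
split=> [[dM dG [delta dH]]|[K /hyp_real_of_nat hK]].
  exact: hyp_nat_of_real (thin_hyp_real dM dG dH).
split; [exact: graph_dist_metric | exact: graph_dist_geodesic |].
by eexists; apply: (hyp_thin_real graph_dist_metric hK).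
Qed.

End MetricGraphTheory.

Local Close Scope ring_scope.
Local Open Scope group_scope.

(** * Cayley graphs *)

Lemma finite_bound T (A : set T) (f : T -> nat) : finite_set A ->
  exists M, forall a, A a -> (f a <= M)%N.
Proof.
move=> /(finite_image f) /finite_seqP[s fA]; exists (\max_(i <- s) i)%N => a Aa.
have : [set` s] (f a) by rewrite -fA; exists a.
by move=> /= fas; apply: (@leq_bigmax_seq _ s predT id).
Qed.

Section Cayley.
Variables (G : groupType) (A : set G).

Lemma generated_subgroup : subgroup (generated A).
Proof.
split=> [H [[]]//|x y hx hy H HA|x hx H HA]; case: (HA) => [[_ hM hV] _].
  by apply: hM; [apply: hx | apply: hy].
by apply: hV; apply: hx.
Qed.

Lemma cayley_adj_sym x y : cayley_adj A x y -> cayley_adj A y x.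
Proof.
case=> xy [a Aa h]; split; first by move=> E; apply: xy.
by exists a => //; case: h; [right | left].
Qed.

Lemma cayley_adj_irr x y : cayley_adj A x y -> x != y.
Proof. by case=> /eqP. Qed.

Lemma cayley_connected : generated A = setT ->
  forall x y, exists n, walk (cayley_adj A) n x y.
Proof.
move=> gA.
pose H := [set g | forall x, exists n, walk (cayley_adj A) n x (x * g)].
have HG : generated A `<=` H.
  apply: smallest_sub.
    split=> [x|g h hg hh x|g hg x]; first by exists 0%N; rewrite mulg1.
      have [m hm] := hg x; have [n hn] := hh (x * g).
      by exists (m + n)%N; rewrite mulgA; apply: walk_cat hm hn.
    have [n hn] := hg (x * g^-1); exists n; rewrite mulgVK in hn.
    by apply: walk_sym hn => ? ?; apply: cayley_adj_sym.
  move=> a Aa x; have [E|nE] := pselect (x = x * a); first by exists 0%N.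
  by exists 1%N; apply: walk1; split=> //; exists a => //; left.
move=> x y; have [n hn] := HG (x^-1 * y) ltac:(by rewrite gA) x.
by exists n; rewrite mulVKg in hn.
Qed.

Lemma cayley_gdist_mul : generated A = setT -> forall g x y,
  (gdist (cayley_adj A) (g * x)%g (g * y)%g <= gdist (cayley_adj A) x y)%N.
Proof.
move=> gA g x y; have conn := cayley_connected gA; rewrite -[leqRHS]mul1n.
apply: (gdist_lipschitz conn (f := fun z => g * z)).
  exact: gdist_geodesic cayley_adj_sym conn.
move=> {x y} x y [xy [a Aa h]]; apply: gdist_le => //; apply: walk1.
split; first by move=> /mulgI.
by exists a => //; rewrite -!mulgA; case: h => ->; [left | right].
Qed.

Lemma cayley_lipschitz (Y : Type) (d : Y -> Y -> nat) (f : G -> Y) L :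
  generated A = setT -> geodesic_nat d ->
  (forall g a, A a -> (d (f g) (f (g * a)%g) <= L)%N) ->
  forall x y, (d (f x) (f y) <= L * gdist (cayley_adj A) x y)%N.
Proof.
move=> gA dG fL; apply: (gdist_lipschitz (cayley_connected gA) dG).
by move=> x y [_ [a Aa [->|->]]]; [|rewrite (gn_sym dG)]; apply: fL.
Qed.

End Cayley.

Lemma cayley_hyp_generators (G : groupType) (A B : set G) K :
  finite_set A -> finite_set B -> generated A = setT -> generated B = setT ->
  hyp_nat (gdist (cayley_adj A)) K -> exists K', hyp_nat (gdist (cayley_adj B)) K'.
Proof.
move=> fA fB gA gB hK.
have GA := gdist_geodesic (@cayley_adj_sym _ A) (cayley_connected gA).
have GB := gdist_geodesic (@cayley_adj_sym _ B) (cayley_connected gB).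
have [M hM] := finite_bound (gdist (cayley_adj B) 1%g) fA.
have [N hN] := finite_bound (gdist (cayley_adj A) 1) fB.
apply: (hyp_quasi_isometric (f := id) (L := M + N) GB GA _ _ hK) => x y.
  apply: leq_trans (_ : N * gdist (cayley_adj B) x y <= _)%N; last by rewrite leq_mul2r leq_addl orbT.
  apply: (cayley_lipschitz (f := id) gB GA) => g b Bb; apply: leq_trans (hN b Bb).
  by rewrite -{1}[g]mulg1; apply: cayley_gdist_mul.
apply: leq_trans (_ : M * gdist (cayley_adj A) x y <= _)%N; last by apply: leq_mul; lia.
apply: (cayley_lipschitz (f := id) gA GB) => g b Bb; apply: leq_trans (hM b Bb).
by rewrite -{1}[g]mulg1; apply: cayley_gdist_mul.
Qed.

(** * Coxeter complexes *)

Definition panel_adj (V : Type) (C C' : set V) : Prop :=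
  exists v v', [/\ C v, C' v' & C `\ v = C' `\ v'].

Lemma panel_adj_sym (V : Type) (C C' : set V) : panel_adj C C' -> panel_adj C' C.
Proof. by move=> [v [v' [? ? ?]]]; exists v', v. Qed.

Definition face_closed (V : Type) (E : set (set V)) : Prop :=
  forall sigma tau, E sigma -> tau `<=` sigma -> E tau.

Section Charts.
Variables (W : groupType) (S : set W) (V : Type).
Hypothesis invS : forall s, S s -> s <> 1 /\ s * s = 1.

(** The chamber system underlying a Coxeter complex, k w being the chamber of w:
   the chambers k w and k (w s) share a
   panel, and each panel of k w lies in exactly two chambers k w and k (w s). *)
Record thin_chart (E : set (set V)) (k : W -> set V) : Prop := ThinChart {
  chart_chamber : forall w, chamber E (k w);
  chart_cover : forall sigma, E sigma -> exists w, sigma `<=` k w;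
  chart_inj : forall w w', k w = k w' -> w = w';
  chart_adj : forall w s, S s -> panel_adj (k w) (k (w * s));
  chart_thin : forall w v, k w v ->
    exists2 s, S s & forall u, k w `\ v `<=` k u -> u = w \/ u = w * s }.

Lemma generated0 x : generated (set0 : set W) x -> x = 1.
Proof.
move=> /(_ [set 1]); apply; split=> //; split=> //.
  by move=> _ _ -> ->; rewrite mulg1.
by move=> _ ->; rewrite invg1.
Qed.

Lemma special_coset1 w : special_coset S [set w].
Proof.
exists w, set0; split=> //; apply/seteqP; split=> [_ ->|_ [x hx <-]] /=.
  by exists 1; [case: (generated_subgroup (set0 : set W)) | rewrite mulg1].
by rewrite (generated0 hx) mulg1.
Qed.

Lemma special_coset2 w s : S s -> special_coset S [set w; w * s].
Proof.
move=> Ss; have [_ ss] := invS Ss; have sV : s^-1 = s by apply: mulg1_eq.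
exists w, [set s]; split; first by move=> _ ->.
have [g1 gM gV] := generated_subgroup [set s].
have gs : generated [set s] s by apply: sub_gen_smallest.
apply/seteqP; split=> [_ [->|->]|_ [x hx <-]] /=.
- by exists 1; rewrite ?mulg1.
- by exists s.
have [->|->] : [set 1; s] x; last by right.
  apply: hx; split; last by move=> _ ->; right.
  split; first by left.
    by move=> _ _ [->|->] [->|->]; rewrite ?mul1g ?mulg1 ?ss; [left|right|right|left].
  by move=> _ [->|->]; rewrite ?invg1 ?sV; [left|right].
by left; rewrite mulg1.
Qed.

Lemma special_coset_nonempty A : special_coset S A -> exists w, A w.
Proof.
move=> [w [T [_ ->]]]; exists w, 1; last by rewrite mulg1.
by case: (generated_subgroup T).
Qed.

(** The smallest special cosets strictly above a chamber are the panels. *)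
Lemma special_coset_edge A w : special_coset S A -> A w -> A <> [set w] ->
  exists2 s, S s & A (w * s).
Proof.
move=> [u [T [TS ->]]] [x hx <-] nA.
have [g1 gM _] := generated_subgroup T.
have [[s Ts]|no] := pselect (exists s, T s).
  exists s; first exact: TS.
  by exists (x * s); rewrite ?mulgA //; apply: gM => //; apply: sub_gen_smallest.
case: nA.
have T0 : T = set0 by apply/seteqP; split=> // s Ts; case: no; exists s.
have g0 y : generated T y -> y = 1 by rewrite T0; apply: generated0.
rewrite (g0 x) // mulg1; apply/seteqP; split=> [_ [y /g0 -> <-]|_ ->] /=.
  by rewrite mulg1.
by exists 1 => //; rewrite mulg1.
Qed.

(** A face of codimension one of the chamber of w corresponds to a special coset
   strictly containing w, hence containing an edge {w, ws}, and the face
   corresponding to that edge is proper; so the two faces agree. *)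
Lemma coxeter_chart E : face_closed E ->
  is_coxeter_complex S E -> exists k, thin_chart E k.
Proof.
move=> Ecl [f [[fE finj fsurj] ford0]].
have ford B A : special_coset S B -> special_coset S A -> B `<=` A <-> f A `<=` f B.
  by move=> sB sA; apply: ford0.
have s1 := special_coset1; have s2 := special_coset2.
have fcov sigma : E sigma -> exists2 A, special_coset S A & f A = sigma.
  by move=> /fsurj[A sA <-]; exists A.
have fmax w : chamber E (f [set w]).
  split; first exact: fE.
  move=> tau /fcov[A sA <-] /(proj2 (ford _ _ sA (s1 w))) Aw.
  suff -> : A = [set w] by [].
  apply/seteqP; split=> // _ ->; have [u Au] := special_coset_nonempty sA.
  by rewrite -(Aw _ Au).
have face w v : f [set w] v ->
    exists2 s, S s & f [set w] `\ v = f [set w; w * s].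
  move=> fv; have [|A sA fA] := fcov (f [set w] `\ v).
    by apply: Ecl (fE _ (s1 w)) _ => u [].
  have Aw : A w.
    by apply: (proj2 (ford _ _ (s1 w) sA)) => //; rewrite fA => u [].
  have [|s Ss Aws] := special_coset_edge sA Aw.
    by move=> E1; move: fv; rewrite -E1 fA => -[_]; apply.
  exists s => //; apply/seteqP; split.
    rewrite -fA; apply/(ford _ _ (s2 w s Ss) sA) => _ [->|->] //.
  move=> u fu; split.
    by apply: (proj1 (ford _ _ (s1 w) (s2 w s Ss))) fu => _ ->; left.
  move=> /= uv; subst u.
  have : f [set w] `<=` f [set w; w * s].
    move=> u fu'; have [->//|uv] := pselect (u = v).
    have : f A `<=` f [set w; w * s].
      by apply/(ford _ _ (s2 w s Ss) sA) => _ [->|->].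
    by apply; rewrite fA; split.
  move=> /(proj2 (ford _ _ (s2 w s Ss) (s1 w))) /(_ (w * s)) /(_ (or_intror erefl)) /= ws.
  by have [] := invS Ss; case; apply: (@mulgI _ w); rewrite ws mulg1.
have face2 w s : S s -> exists2 v, f [set w] v & f [set w] `\ v = f [set w; w * s].
  move=> Ss; have sub : f [set w; w * s] `<=` f [set w].
    by apply: (proj1 (ford _ _ (s1 w) (s2 w s Ss))) => _ ->; left.
  have [v fv nv] : exists2 v, f [set w] v & ~ f [set w; w * s] v.
    apply: contrapT => no.
    have : f [set w] `<=` f [set w; w * s].
      by move=> v fv; apply: contrapT => nv; apply: no; exists v.
    move=> /(proj2 (ford _ _ (s2 w s Ss) (s1 w))) /(_ (w * s)) /(_ (or_intror erefl)) /= ws.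
    by have [] := invS Ss; case; apply: (@mulgI _ w); rewrite ws mulg1.
  exists v => //; have [t St fvt] := face w v fv.
  have : f [set w; w * s] `<=` f [set w; w * t].
    by rewrite -fvt => u fu; split; [exact: sub | move=> /= uv; apply: nv; rewrite -uv].
  move=> /(proj2 (ford _ _ (s2 w t St) (s2 w s Ss))) /(_ (w * t)) /(_ (or_intror erefl)).
  case=> /= E1; last by rewrite fvt E1.
  by have [] := invS St; case; apply: (@mulgI _ w); rewrite E1 mulg1.
exists (fun w => f [set w]); split=> //.
- move=> sigma /fcov[A sA <-]; have [w Aw] := special_coset_nonempty sA.
  by exists w; apply: (proj1 (ford _ _ (s1 w) sA)) => _ ->.
- move=> w w' E1; have /(_ w) : [set w] `<=` [set w'].
    by apply: (proj2 (ford _ _ (s1 w) (s1 w'))); rewrite E1.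
  by apply.
- move=> w s Ss; have [v fv E1] := face2 w s Ss; have [v' fv' E2] := face2 (w * s) s Ss.
  exists v, v'; split=> //; rewrite E1 E2 -mulgA (invS Ss).2 mulg1.
  by congr f; rewrite setUC.
- move=> w v fv; have [s Ss E1] := face w v fv; exists s => // u; rewrite E1 => sub.
  have := proj2 (ford _ _ (s1 u) (s2 w s Ss)) sub.
  by move=> /(_ u erefl) [->|->]; [left|right].
Qed.

End Charts.

(** * Isomorphisms of complexes, and their rigidity on apartments *)

Section ComplexIso.
Variable V : Type.
Implicit Types (E F H : set (set V)) (phi psi : V -> V) (sigma tau : set V).

Lemma simplex_vertices E sigma : face_closed E -> E sigma -> sigma `<=` vertices E.
Proof. by move=> Ecl Es v sv; apply: Ecl Es _ => _ ->. Qed.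

Lemma iso_injective E F phi : complex_iso E F phi -> forall u v,
  vertices E u -> vertices E v -> phi u = phi v -> u = v.
Proof. by case=> [[_ inj _] _] u v Eu Ev; apply: inj; rewrite inE. Qed.

Lemma iso_simplex E F phi sigma : face_closed E -> complex_iso E F phi ->
  E sigma -> F (phi @` sigma).
Proof. by move=> Ecl [_ iso] Es; apply/iso => //; exact: simplex_vertices. Qed.

Lemma iso_subset E F phi sigma tau : face_closed E -> complex_iso E F phi ->
  E sigma -> E tau -> phi @` sigma `<=` phi @` tau -> sigma `<=` tau.
Proof.
move=> Ecl iso Es Et sub v sv; have [u tu uv] := sub (phi v) (ex_intro2 _ _ v sv erefl).
have [Ev Eu] := (simplex_vertices Ecl Es sv, simplex_vertices Ecl Et tu).
by rewrite -(iso_injective iso Eu Ev uv).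
Qed.

Lemma iso_image_inj E F phi sigma tau : face_closed E -> complex_iso E F phi ->
  E sigma -> E tau -> phi @` sigma = phi @` tau -> sigma = tau.
Proof.
move=> Ecl iso Es Et eq; apply/seteqP; split; apply: (iso_subset Ecl iso) => //;
  by move=> y; rewrite eq.
Qed.

Lemma iso_preimage E F phi tau : face_closed F -> complex_iso E F phi ->
  F tau -> exists2 sigma, E sigma & phi @` sigma = tau.
Proof.
move=> Fcl [[_ _ surj] iso] Ft.
pose sigma := vertices E `&` phi @^-1` tau.
have phis : phi @` sigma = tau.
  apply/seteqP; split=> [_ [v [_ pv] <-]//|v tv].
  have [u Eu uv] := surj v (simplex_vertices Fcl Ft tv).
  by exists u => //; split=> //; rewrite /preimage /= uv.
by exists sigma => //; apply/iso; [move=> v [] | rewrite phis].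
Qed.

Lemma iso_comp E F H phi psi : face_closed E -> complex_iso E F phi ->
  complex_iso F H psi -> complex_iso E H (psi \o phi).
Proof.
move=> Ecl isoE isoF; split; first exact: set_bij_comp isoE.1 isoF.1.
move=> sigma sE; rewrite isoE.2 // -image_comp isoF.2 //.
by move=> _ [v sv <-]; case: isoE.1 => f _ _; apply: f; apply: sE.
Qed.

Lemma iso_chamber E F phi C : face_closed E -> face_closed F ->
  complex_iso E F phi -> chamber E C -> chamber F (phi @` C).
Proof.
move=> Ecl Fcl iso [EC Cmax]; split; first exact: iso_simplex iso EC.
move=> tau /(iso_preimage Fcl iso)[sigma Es <-] sub.
by congr image; apply: Cmax => //; apply: iso_subset iso _ _ sub.
Qed.

Lemma iso_setD1 E F phi sigma v : face_closed E -> complex_iso E F phi ->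
  E sigma -> sigma v -> phi @` (sigma `\ v) = phi @` sigma `\ phi v.
Proof.
move=> Ecl iso Es sv; apply/seteqP; split=> [_ [u [su uv] <-]|_ [[u su <-] uv]].
  split; first by exists u.
  move=> /= E1; apply: uv.
  by apply: (iso_injective iso _ _ E1); apply: (simplex_vertices Ecl Es).
by exists u => //; split=> // E1; apply: uv; rewrite E1.
Qed.

Lemma iso_panel_adj E F phi C C' : face_closed E -> complex_iso E F phi ->
  E C -> E C' -> panel_adj C C' -> panel_adj (phi @` C) (phi @` C').
Proof.
move=> Ecl iso EC EC' [v [v' [Cv Cv' eq]]]; exists (phi v), (phi v').
split; [by exists v | by exists v' |].
by rewrite -!(iso_setD1 Ecl iso) // eq.
Qed.

End ComplexIso.

Section Apartments.
Variables (W : groupType) (S : set W) (V : Type).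
Hypothesis invS : forall s, S s -> s <> 1 /\ s * s = 1.
Hypothesis genS : generated S = setT.

Lemma cayley_adj_right w w' : cayley_adj S w w' -> exists2 s, S s & w' = w * s.
Proof.
case=> _ [s Ss [->|->]]; first by exists s.
by exists s => //; rewrite -mulgA (invS Ss).2 mulg1.
Qed.

Lemma chart_onto E k C : @thin_chart W S V E k -> chamber E C -> exists w, k w = C.
Proof.
move=> ck [EC Cmax]; have [w sub] := chart_cover ck EC.
by exists w; apply: Cmax => //; case: (chart_chamber ck w).
Qed.

Lemma chart_adj_dist E k w w' : @thin_chart W S V E k -> panel_adj (k w) (k w') ->
  (gdist (cayley_adj S) w w' <= 1)%N.
Proof.
move=> ck [v [v' [kv _ eq]]]; have conn := cayley_connected genS.
have [s Ss /(_ w')[|->|->]] := chart_thin ck kv; first by rewrite eq => u [].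
  by apply: (@leq_trans 0); first exact: gdist_le.
apply: gdist_le => //; apply: walk1; split; last by exists s => //; left.
rewrite -{1}[w]mulg1 => /mulgI E1; by case: (invS Ss) => -[].
Qed.

(** Isomorphisms that agree on a chamber C agree on each adjacent chamber C': the
   images of C' are both different from the common image of C and share the same
   panel with it, so they coincide by thinness of the target; as the two maps
   agree on this panel, they agree on the remaining vertex of C'.  Galleries
   then reach every chamber. *)
Lemma iso_rigid E F k l phi psi w0 : face_closed E -> face_closed F ->
  @thin_chart W S V E k -> @thin_chart W S V F l ->
  complex_iso E F phi -> complex_iso E F psi ->
  (forall v, k w0 v -> phi v = psi v) ->
  forall w v, k w v -> phi v = psi v.
Proof.
move=> Ecl Fcl ck cl iphi ipsi agree w.
have [n hn] := cayley_connected genS w0 w.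
elim: n w0 agree hn => [|n IH] w0 agree; first by move=> <-.
case=> w1 /cayley_adj_right[s Ss ->]; apply: IH => {w n} v kv.
have Ek u : E (k u) by case: (chart_chamber ck u).
have im f u : complex_iso E F f -> exists a, l a = f @` k u.
  by move=> isof; apply: (chart_onto cl); exact: (iso_chamber Ecl Fcl isof (chart_chamber ck u)).
have eq0 : phi @` k w0 = psi @` k w0 by apply: eq_imagel.
have [x [x' [kx kx' eq]]] := chart_adj ck w0 Ss.
have agree' u : (k (w0 * s) `\ x') u -> phi u = psi u.
  by rewrite -eq => -[ku _]; apply: agree.
have [a Ea] := im phi w0 iphi.
have [b Eb] := im phi (w0 * s) iphi; have [b' Eb'] := im psi (w0 * s) ipsi.
have nws : w0 <> w0 * s.
  by rewrite -{1}[w0]mulg1 => /mulgI E1; case: (invS Ss) => -[].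
have nb : b <> a.
  move=> E1; rewrite E1 Ea in Eb; apply: nws; apply: (chart_inj ck).
  exact: iso_image_inj iphi _ _ Eb.
have nb' : b' <> a.
  move=> E1; rewrite E1 Ea eq0 in Eb'; apply: nws; apply: (chart_inj ck).
  exact: iso_image_inj ipsi _ _ Eb'.
have lax : l a (phi x) by rewrite Ea; exists x.
have panel f : (forall u, (k (w0 * s) `\ x') u -> phi u = f u) ->
    l a `\ phi x `<=` f @` k (w0 * s).
  move=> fE; rewrite Ea -(iso_setD1 Ecl iphi) // eq => _ [u ku <-].
  by rewrite fE //; exists u => //; case: ku.
have [t St tE] := chart_thin cl lax.
have bb : b = b'.
  have [|/nb[]|->] := tE b; first by rewrite Eb; apply: panel.
  by have [|/nb'[]|->] := tE b'; first by rewrite Eb'; apply: panel.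
have eqs : phi @` k (w0 * s) = psi @` k (w0 * s) by rewrite -Eb -Eb' bb.
(* Only the vertex x' of the chamber k (w0 * s) is not on the panel. *)
have [E1|nE] := pselect (v = x'); last by apply: agree'; split.
subst v; have : (psi @` k (w0 * s)) (phi x') by rewrite -eqs; exists x'.
case=> u ku uE; have [E1|nE] := pselect (u = x'); first by rewrite -uE E1.
have E2 : u = x'.
  apply: (iso_injective iphi); last by rewrite agree' //; split.
    exact: (simplex_vertices Ecl (Ek (w0 * s))).
  exact: (simplex_vertices Ecl (Ek (w0 * s))).
by case: nE.
Qed.

End Apartments.

(** * The chamber graph of a building *)

Section Building.
Variables (W : groupType) (S : set W) (V : Type).
Hypothesis invS : forall s, S s -> s <> 1 /\ s * s = 1.
Hypothesis genS : generated S = setT.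
Variables (Delta : set (set V)) (Apt : set (set (set V))).
Hypothesis DeltaC : simplicial_complex Delta.
Hypothesis aptS : apartment_system S Delta Apt.

Lemma apartment_sub E : Apt E -> E `<=` Delta.
Proof. by case: aptS => h _ _ _ /h[[]]. Qed.

Lemma apartment_closed E : Apt E -> face_closed E.
Proof. by case: aptS => h _ _ _ /h[[]]. Qed.

Lemma apartment_chart E : Apt E -> exists k, @thin_chart W S V E k.
Proof.
move=> AE; apply: coxeter_chart => //; first exact: apartment_closed.
by case: aptS => h _ _ _; case: (h _ AE).
Qed.

Lemma apartment_two sigma tau : Delta sigma -> Delta tau ->
  exists E, [/\ Apt E, E sigma & E tau].
Proof. by case: aptS => _ _ h _; apply: h. Qed.

Lemma apartment_iso E F sigma tau : Apt E -> Apt F -> E sigma -> E tau ->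
  F sigma -> F tau -> exists phi, [/\ complex_iso E F phi,
    forall v, sigma v -> phi v = v & forall v, tau v -> phi v = v].
Proof.
case: aptS => _ _ _ h AE AF Es Et Fs Ft.
have [phi [iso fixv]] := h E F sigma tau AE AF Es Et Fs Ft.
by exists phi; split=> // v sv; apply: fixv; [left | right].
Qed.

Lemma fixed_image (phi : V -> V) (sigma : set V) :
  (forall v, sigma v -> phi v = v) -> phi @` sigma = sigma.
Proof. by move=> fixv; rewrite -[RHS]image_id; apply: eq_imagel. Qed.

(** An apartment containing C and a larger simplex is isomorphic over C to E, in
   which C is maximal. *)
Lemma apartment_chamber E C : Apt E -> chamber E C -> chamber Delta C.
Proof.
move=> AE [EC Cmax]; split; first exact: apartment_sub EC.
move=> tau Dt sub; have [F [AF FC Ft]] := apartment_two (apartment_sub AE EC) Dt.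
have [phi [iso fixC _]] := apartment_iso AE AF EC EC FC FC.
have [Ecl Fcl] := (apartment_closed AE, apartment_closed AF).
have [sigma Es sE] := iso_preimage Fcl iso Ft.
have sC : sigma = C.
  apply: Cmax => //; apply: (iso_subset Ecl iso) => //.
  by rewrite sE fixed_image.
by rewrite -sE sC fixed_image.
Qed.

Lemma chamber_apartment E C : Apt E -> chamber Delta C -> E C -> chamber E C.
Proof.
by move=> AE [_ Cmax] EC; split=> // tau Et; apply: Cmax; apply: apartment_sub Et.
Qed.

Definition chambers : Type := {C : set V | chamber Delta C}.

Definition chamber_adj (C C' : chambers) : Prop := panel_adj (sval C) (sval C').

Lemma chamber_eq (C C' : chambers) : sval C = sval C' -> C = C'.
Proof.
case: C C' => [C p] [C' q] /= E; subst C'.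
by congr exist; apply: Prop_irrelevance.
Qed.

Lemma chamber_adj_sym C C' : chamber_adj C C' -> chamber_adj C' C.
Proof. exact: panel_adj_sym. Qed.

Local Notation dW := (gdist (cayley_adj S)).
Local Notation dC := (gdist chamber_adj).

Lemma gallery_of_walk (f : W -> set V) :
  (forall w, chamber Delta (f w)) ->
  (forall w s, S s -> panel_adj (f w) (f (w * s))) ->
  forall n w w', walk (cayley_adj S) n w w' ->
  forall C C' : chambers, sval C = f w -> sval C' = f w' -> walk chamber_adj n C C'.
Proof.
move=> fc fadj; elim=> [|n IH] w w' /=.
  by move=> -> C C' Cw C'w; apply: chamber_eq; rewrite Cw C'w.
case=> u /(cayley_adj_right invS)[s Ss ->] hw C C' Cw C'w.
exists (exist _ _ (fc (w * s))); last exact: IH hw _ _ _ _.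
by rewrite /chamber_adj Cw; apply: fadj.
Qed.

Lemma chamber_connected C C' : exists n, walk chamber_adj n C C'.
Proof.
have [E [AE EC EC']] := apartment_two (svalP C).1 (svalP C').1.
have [k ck] := apartment_chart AE.
have [w wC] := chart_onto ck (chamber_apartment AE (svalP C) EC).
have [w' wC'] := chart_onto ck (chamber_apartment AE (svalP C') EC').
have [n hn] := cayley_connected genS w w'; exists n.
apply: (@gallery_of_walk k _ _ _ _ _ hn) => // [u|u s Ss]; last exact: (chart_adj ck).
exact: apartment_chamber (chart_chamber ck u).
Qed.

Lemma chamber_geodesic : geodesic_nat dC.
Proof. exact: gdist_geodesic chamber_adj_sym chamber_connected. Qed.

Lemma gallery_dist (f : W -> set V) :
  (forall w, chamber Delta (f w)) ->
  (forall w s, S s -> panel_adj (f w) (f (w * s))) ->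
  forall w w' (C C' : chambers), sval C = f w -> sval C' = f w' -> (dC C C' <= dW w w')%N.
Proof.
move=> fc fadj w w' C C' Cw C'w; apply: gdist_le; first exact: chamber_connected.
apply: (gallery_of_walk fc fadj _ Cw C'w).
by apply: gdist_walk; apply: cayley_connected.
Qed.

(** The chamber r C of the apartment E (in terms of the chart k) is the one sent
   to C by an isomorphism, fixing c, from E onto an apartment F through c and C.
   If C and C' share a panel, an isomorphism from F to F' fixing c and this panel
   exists; by rigidity its composite with the isomorphism E to F is the
   isomorphism E to F', so the two preimages of the panel in E are the same. *)
Lemma chamber_retraction E k a (c : chambers) : Apt E -> thin_chart S E k -> k a = sval c ->
  exists r : chambers -> W,
    [/\ forall b (C : chambers), sval C = k b -> r C = b,
        forall C C', (dW (r C) (r C') <= dC C C')%N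
      & forall C, (dC c C <= dW a (r C))%N].
Proof.
move=> AE ck kac; have Ecl := apartment_closed AE.
have Ec : E (sval c) by rewrite -kac; case: (chart_chamber ck a).
have Ek w : E (k w) by case: (chart_chamber ck w).
have Dc := (svalP c).1.
pose spec (C : chambers) b := exists F psi, [/\ Apt F, F (sval c), F (sval C), complex_iso E F psi
   & (forall v, sval c v -> psi v = v) /\ psi @` k b = sval C].
have [r hr] : {r : chambers -> W & forall C, spec C (r C)}.
  apply: (@choice _ _ spec) => C; have [F [AF Fc FC]] := apartment_two Dc (svalP C).1.
  have [psi [iso fixc _]] := apartment_iso AE AF Ec Ec Fc Fc.
  have [sigma Es sE] := iso_preimage (apartment_closed AF) iso FC.
  have [b sub] := chart_cover ck Es; exists b, F, psi; split=> //; split=> //.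
  case: (svalP C) => _; apply; last by rewrite -sE; apply: image_subset.
  by apply: apartment_sub AF _ _; apply: iso_simplex iso (Ek b).
have rigid F phi psi : Apt F -> complex_iso E F phi -> complex_iso E F psi ->
    (forall v, sval c v -> phi v = v) -> (forall v, sval c v -> psi v = v) ->
    forall w, phi @` k w = psi @` k w /\ forall v, k w v -> phi v = psi v.
  move=> AF iphi ipsi fphi fpsi w; have [l cl] := apartment_chart AF.
  have ag : forall v, k w v -> phi v = psi v.
    apply: (iso_rigid invS genS Ecl (apartment_closed AF) ck cl iphi ipsi (w0 := a)).
    by move=> v; rewrite kac => cv; rewrite fphi // fpsi.
  by split=> //; apply: eq_imagel.
exists r; split.
- move=> b C Cb; have [F [psi [AF Fc FC ipsi [fpsi pC]]]] := hr C.
  have EC : E (sval C) by rewrite Cb.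
  have [theta [itheta ftheta fC]] := apartment_iso AE AF Ec EC Fc FC.
  apply: (chart_inj ck); apply: (iso_image_inj Ecl ipsi) => //.
  have [<- _] := rigid F theta psi AF itheta ipsi ftheta fpsi b.
  by rewrite pC -Cb fixed_image.
- move=> C C'; rewrite -[leqRHS]mul1n.
  apply: (gdist_lipschitz chamber_connected).
    exact: gdist_geodesic (@cayley_adj_sym _ S) (cayley_connected genS).
  move=> {}C {}C' [v [v' [Cv Cv' eq]]].
  have [F [psi [AF Fc FC ipsi [fpsi pC]]]] := hr C.
  have [F' [psi' [AF' Fc' FC' ipsi' [fpsi' pC']]]] := hr C'.
  have Ft : F (sval C `\ v) by apply: (apartment_closed AF) FC _ => u [].
  have Ft' : F' (sval C `\ v) by rewrite eq; apply: (apartment_closed AF') FC' _ => u [].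
  have [theta [itheta ftheta ft]] := apartment_iso AF AF' Fc Ft Fc' Ft'.
  have icomp := iso_comp Ecl ipsi itheta.
  have fcomp u : sval c u -> (theta \o psi) u = u by move=> cu; rewrite /= fpsi // ftheta.
  have [_ ag] := rigid F' _ psi' AF' icomp ipsi' fcomp fpsi' (r C).
  have [x kx xv] : (psi @` k (r C)) v by rewrite pC.
  have [x' kx' xv'] : (psi' @` k (r C')) v' by rewrite pC'.
  apply: (chart_adj_dist invS genS ck); exists x, x'; split=> //.
  apply: (iso_image_inj Ecl ipsi').
  + by apply: Ecl (Ek (r C)) _ => u [].
  + by apply: Ecl (Ek (r C')) _ => u [].
  rewrite [RHS](iso_setD1 Ecl ipsi') // pC' xv' -eq.
  have <- : (theta \o psi) @` (k (r C) `\ x) = psi' @` (k (r C) `\ x).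
    by apply: eq_imagel => u [ku _]; apply: ag.
  by rewrite -image_comp (iso_setD1 Ecl ipsi) // pC xv fixed_image.
- move=> C; have [F [psi [AF Fc FC ipsi [fpsi pC]]]] := hr C.
  have Fcl := apartment_closed AF.
  apply: (gallery_dist (f := fun w => psi @` k w)) => //.
  + move=> w; apply: apartment_chamber AF _; apply: iso_chamber ipsi _ => //.
    exact: (chart_chamber ck).
  + by move=> w s Ss; apply: iso_panel_adj ipsi _ _ _ => //; apply: (chart_adj ck).
  + by rewrite kac fixed_image.
Qed.

Lemma chamber_graph_hyp K : hyp_nat dW K -> exists K', hyp_nat dC K'.
Proof.
apply: hyp_retractions.
- exact: chamber_geodesic.
- exact: gdist_geodesic (@cayley_adj_sym _ S) (cayley_connected genS).
move=> C C'; have [E [AE EC EC']] := apartment_two (svalP C).1 (svalP C').1.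
have [k ck] := apartment_chart AE.
have kD w : chamber Delta (k w) by apply: apartment_chamber (chart_chamber ck w).
exists (fun w => exist _ (k w) (kD w)); split.
- have [w wC] := chart_onto ck (chamber_apartment AE (svalP C) EC).
  by exists w; apply: chamber_eq.
- have [w wC] := chart_onto ck (chamber_apartment AE (svalP C') EC').
  by exists w; apply: chamber_eq.
- move=> a b; apply: (gallery_dist kD) => //; exact: (chart_adj ck).
- move=> a; have [|r [r1 r2 r3]] := @chamber_retraction E k a (exist _ (k a) (kD a)) AE ck.
    by [].
  by exists r; split=> // b; apply: r1.
Qed.

Lemma chamber_exists : inhabited chambers.
Proof.
have D0 : Delta set0 by case: DeltaC.
have [E [AE _ _]] := apartment_two D0 D0; have [k ck] := apartment_chart AE.
exact: (inhabits (exist _ (k 1) (apartment_chamber AE (chart_chamber ck 1)))).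
Qed.

(** The generators inject into the vertices of the chamber k 1: each one
   determines a panel of k 1, thus the vertex opposite to it, and conversely by
   thinness. *)
Lemma generators_finite : finite_set S.
Proof.
have D0 : Delta set0 by case: DeltaC.
have [E [AE _ _]] := apartment_two D0 D0.
have [k ck] := apartment_chart AE.
have fk : finite_set (k 1).
  case: DeltaC => _ _ h _; apply: h; apply: (apartment_sub AE).
  by case: (chart_chamber ck 1).
have [g hg] : {g : V -> W & forall v, k 1 v -> forall u, k 1 `\ v `<=` k u -> u = 1 \/ u = g v}.
  apply: (@choice _ _ (fun v t => k 1 v -> forall u, k 1 `\ v `<=` k u -> u = 1 \/ u = t)) => v.
  have [kv|nk] := pselect (k 1 v); last by exists 1.
  by have [s _ hs] := chart_thin ck kv; exists (1 * s).
apply: sub_finite_set (finite_image g fk) => s Ss.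
have [v [v' [kv kv' eq]]] := chart_adj ck 1 Ss.
exists v => //; have [|E1|<-] := hg v kv (1 * s); last by rewrite mul1g.
  by rewrite eq => u [].
by case: (invS Ss) => -[]; rewrite -[s]mul1g.
Qed.

End Building.

(** * Actions on the chamber graph *)

Section Action.
Variables (G : groupType) (V : Type) (Delta : set (set V)) (to : G -> V -> V).
Hypothesis DeltaC : simplicial_complex Delta.
Hypothesis act : simplicial_action Delta to.

Lemma act1 sigma : to 1 @` sigma = sigma.
Proof.
have [to1 _ _] := act; rewrite -[RHS]image_id; apply: eq_imagel => v _; exact: to1.
Qed.

Lemma actM g h sigma : to (g * h) @` sigma = to g @` (to h @` sigma).
Proof.
have [_ toM _] := act; rewrite image_comp; apply: eq_imagel => v _; exact: toM.
Qed.

Lemma actK g sigma : to g^-1 @` (to g @` sigma) = sigma.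
Proof. by rewrite -actM mulVg act1. Qed.

Lemma actVK g sigma : to g @` (to g^-1 @` sigma) = sigma.
Proof. by rewrite -actM mulgV act1. Qed.

Lemma act_inj g u v : to g u = to g v -> u = v.
Proof.
have [to1 toM _] := act; move=> /(congr1 (to g^-1)).
by rewrite -!toM mulVg !to1.
Qed.

Lemma act_setD1 g sigma v : to g @` (sigma `\ v) = to g @` sigma `\ to g v.
Proof.
apply/seteqP; split=> [_ [u [su uv] <-]|_ [[u su <-] uv]].
  by split; [exists u | move=> /= /act_inj].
by exists u => //; split=> // E; apply: uv; rewrite E.
Qed.

Lemma act_chamber g C : chamber Delta C -> chamber Delta (to g @` C).
Proof.
have [_ _ toD] := act => -[DC Cmax]; split; first exact: toD.
move=> tau Dt sub; rewrite -[LHS](actVK g); congr image; apply: Cmax; first exact: toD.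
by rewrite -[X in X `<=` _](actK g); apply: image_subset.
Qed.

Lemma act_panel_adj g C C' : panel_adj C C' -> panel_adj (to g @` C) (to g @` C').
Proof.
move=> [v [v' [Cv Cv' eq]]]; exists (to g v), (to g v').
by split; [exists v | exists v' | rewrite -!act_setD1 eq].
Qed.

(** It is empty or a coset of the stabilizer of tau. *)
Lemma transporter_finite sigma tau : finite_set (setwise_stabilizer to tau) ->
  finite_set [set u | to u @` tau = sigma].
Proof.
move=> fin; have [[u0 E0]|no] := pselect (exists u, to u @` tau = sigma); last first.
  suff -> : [set u | to u @` tau = sigma] = set0 by apply: finite_set0.
  by apply/seteqP; split=> // u E; case: no; exists u.
apply: sub_finite_set (finite_image (fun g => u0 * g) fin) => u /= E.
exists (u0^-1 * u); last by rewrite mulVKg.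
by rewrite /setwise_stabilizer /= actM E -E0 actK.
Qed.

Definition act_chambers (g : G) (C : chambers Delta) : chambers Delta :=
  exist _ (to g @` sval C) (act_chamber g (svalP C)).

Hypothesis cocpt : cocompact Delta to.

Lemma chamber_representatives (C0 : chambers Delta) : exists2 Rp : set (chambers Delta),
  finite_set Rp & Rp C0 /\ forall C, exists E g, Rp E /\ C = act_chambers g E.
Proof.
pose orb (C : chambers Delta) := simplex_orbit to (sval C).
(* Orbits of simplices that are not chambers get the representative C0. *)
pose pick (O : set (set V)) : chambers Delta :=
  if pselect (exists C, orb C = O) is left h then projT1 (cid h) else C0.
exists (C0 |` pick @` [set simplex_orbit to sigma | sigma in Delta]).
  by rewrite finite_setU; split; [exact: finite_set1 | exact: finite_image].
split; first by left.
move=> C; have pickE : orb (pick (orb C)) = orb C.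
  rewrite /pick; case: pselect => [h|[]]; last by exists C.
  by case: (cid h).
have : orb C (sval C) by exists 1 => //; exact: act1.
rewrite -pickE => -[g _ gE]; exists (pick (orb C)), g; split; last exact: chamber_eq.
by right; exists (orb C) => //; exists (sval C) => //; case: (svalP C).
Qed.

Hypothesis stab : finite_stabilizers Delta to.

Definition chamber_near (C C' : chambers Delta) := C = C' \/ chamber_adj C C'.

(** A chamber E and a translate of E' that are equal or share a panel determine,
   among finitely many pairs of chambers or of panels, one pair that the group
   element transports to each other; such elements form a coset of a finite
   stabilizer. *)
Lemma neighbour_set_finite (Rp : set (chambers Delta)) : finite_set Rp ->
  finite_set [set u | exists E E', [/\ Rp E, Rp E' & chamber_near E (act_chambers u E')]].
Proof.
move=> fR.
have finC (C : chambers Delta) : finite_set (sval C).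
  by case: DeltaC => _ _ h _; apply: h; case: (svalP C).
have face (C : chambers Delta) v : Delta (sval C `\ v).
  by case: DeltaC => _ _ _ h; apply: h (svalP C).1 _ => u [].
pose F (E E' : chambers Delta) := [set u | to u @` sval E' = sval E] `|`
  \bigcup_(v in sval E) \bigcup_(v' in sval E') [set u | to u @` (sval E' `\ v') = sval E `\ v].
apply: (@sub_finite_set _ _ (\bigcup_(E in Rp) \bigcup_(E' in Rp) F E E')).
  move=> u [E [E' [RE RE' nE]]]; exists E => //; exists E' => //.
  case: nE => [->|[v [_ [Ev [v' E'v' <-] eq]]]]; first by left.
  by right; exists v => //; exists v' => //=; rewrite act_setD1 eq.
apply: bigcup_finite => // E RE; apply: bigcup_finite => // E' RE'.
rewrite finite_setU; split.
  apply: transporter_finite; apply: stab; first by case: (svalP E').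
  by constructor 2; exact: (svalP E').
apply: bigcup_finite => // v Ev; apply: bigcup_finite => // v' Ev'.
apply: transporter_finite; apply: stab; first exact: face.
by constructor 3; exists (sval E'), v'; split=> //; exact: (svalP E').
Qed.

Hypothesis conn : forall C C' : chambers Delta, exists n, walk (@chamber_adj _ Delta) n C C'.

Local Notation dC := (gdist (@chamber_adj _ Delta)).

Lemma chamber_dist_act g C C' : (dC (act_chambers g C) (act_chambers g C') <= dC C C')%N.
Proof.
rewrite -[leqRHS]mul1n; apply: (gdist_lipschitz conn (f := act_chambers g)).
  exact: gdist_geodesic (@chamber_adj_sym _ Delta) conn.
move=> {}C {}C' CC'; apply: gdist_le => //; apply: walk1; exact: act_panel_adj.
Qed.

Lemma act_chambersM g h C : act_chambers (g * h) C = act_chambers g (act_chambers h C).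
Proof. by apply: chamber_eq; rewrite /= actM. Qed.

(** Write the chambers of a gallery from g C0 to h C0 as translates g_i E_i of
   representatives of the orbits: each quotient of consecutive g_i belongs to the
   finite set of [neighbour_set_finite], hence has bounded word length. *)
Lemma orbit_map_quasi_isometric (A : set G) (C0 : chambers Delta) :
  finite_set A -> generated A = setT -> exists L,
  (forall g h, (dC (act_chambers g C0) (act_chambers h C0) <= L * gdist (cayley_adj A) g h)%N) /\
  (forall g h, (gdist (cayley_adj A) g h <= L * (dC (act_chambers g C0) (act_chambers h C0) + 1))%N).
Proof.
move=> fA gA.
have gC := gdist_geodesic (@chamber_adj_sym _ Delta) conn.
have aconn := cayley_connected gA.
have gG := gdist_geodesic (@cayley_adj_sym _ A) aconn.
have [L1 hL1] := finite_bound (fun a => dC C0 (act_chambers a C0)) fA.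
have [Rp fR [RC0 Rall]] := chamber_representatives C0.
have [L2 hL2] := finite_bound (gdist (cayley_adj A) 1) (neighbour_set_finite fR).
have step g h E E' : Rp E -> Rp E' -> chamber_near (act_chambers g E) (act_chambers h E') ->
    (gdist (cayley_adj A) g h <= L2)%N.
  move=> RE RE' near.
  have : chamber_near E (act_chambers (g^-1 * h) E').
    have gE C : act_chambers g^-1 (act_chambers g C) = C.
      by apply: chamber_eq; rewrite /= actK.
    rewrite act_chambersM -{1}[E]gE; case: near => [->|adj]; first by left.
    by right; apply: act_panel_adj.
  move=> nE; apply: leq_trans (hL2 (g^-1 * h) _); last by exists E, E'.
  by rewrite -{1}[g]mulg1 -{1}[h](mulVKg g); apply: cayley_gdist_mul.
have lower n : forall C C', walk (@chamber_adj _ Delta) n C C' -> forall g h E E', Rp E -> Rp E' ->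
    C = act_chambers g E -> C' = act_chambers h E' -> (gdist (cayley_adj A) g h <= L2 * (n + 1))%N.
  elim: n => [|n IH] C C'.
    move=> /= -> g h E E' RE RE' CE C'E; rewrite add0n muln1.
    by apply: (step _ _ E E') => //; left; rewrite -CE.
  case=> C1 CC1 hw g h E E' RE RE' CE C'E; have [E1 [u [RE1 C1E]]] := Rall C1.
  apply: leq_trans (gn_tri gG g u h) _; rewrite addSn mulnS leq_add //.
    by apply: (step _ _ E E1) => //; right; rewrite -CE -C1E.
  exact: IH hw _ _ _ _ RE1 RE' C1E C'E.
exists (L1 + L2)%N; split=> g h.
  apply: leq_trans (_ : L1 * gdist (cayley_adj A) g h <= _)%N; last by rewrite leq_mul2r leq_addr orbT.
  apply: (cayley_lipschitz (f := fun g => act_chambers g C0) gA gC) => k a Aa.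
  by apply: leq_trans (hL1 a Aa); rewrite act_chambersM; apply: chamber_dist_act.
apply: leq_trans (_ : L2 * (dC (act_chambers g C0) (act_chambers h C0) + 1) <= _)%N.
  exact: (lower _ _ _ (gdist_walk conn _ _) g h C0 C0).
by rewrite leq_mul2r leq_addl orbT.
Qed.

End Action.

Theorem mainTheorem3 (R : realType)
    (W : groupType) (S : set W)
    (coxWS : coxeter_system S) (hypW : word_hyperbolic W R)
    (V : Type) (Delta : set (set V)) (bDelta : building S Delta)
    (G : groupType) (fgG : finitely_generated G)
    (to : G -> V -> V) (act : simplicial_action Delta to)
    (cocpt : cocompact Delta to) (stab : finite_stabilizers Delta to) :
  word_hyperbolic G R.
Proof.
have [invS genS _] := coxWS; have [DeltaC [Apt aptS]] := bDelta.
have [A fA gA] := fgG; have [B [fB gB hB]] := hypW.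
have conn := chamber_connected invS genS aptS.
have hypG (H : groupType) (T : set H) : generated T = setT ->
    hyperbolic_space (@graph_dist R H (cayley_adj T)) <->
    exists K, hyp_nat (gdist (cayley_adj T)) K.
  move=> gT; apply: hyperbolic_graphP; last exact: cayley_connected.
    exact: cayley_adj_sym.
  exact: cayley_adj_irr.
have [K0 hB0] := (hypG W B gB).1 hB.
have [K1 hS] := cayley_hyp_generators fB (generators_finite invS DeltaC aptS) gB genS hB0.
have [K2 hC] := chamber_graph_hyp invS genS aptS hS.
have [C0] := chamber_exists invS DeltaC aptS.
exists A; split=> //; apply/(hypG G A gA).
have [L [up low]] := orbit_map_quasi_isometric DeltaC act cocpt stab conn C0 fA gA.
have gC := gdist_geodesic (@chamber_adj_sym _ Delta) conn.
have gG := gdist_geodesic (@cayley_adj_sym _ A) (cayley_connected gA).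
exact: (hyp_quasi_isometric gG gC up low hC).
Qed.
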